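(* Let $X=\mathbb{G}(1,5)\cap H^2$ be a general linear section of codimension $2$ of the Grassmannian $\mathbb{G}(1,5)$ of lines in $\mathbb{P}^5_{\mathbb{C}}$ (under the Plücker embedding), with exceptional lines $l_1,l_2,l_3\subset\mathbb{P}^5$ and associated union of $3$-planes $V=V_1\cup V_2\cup V_3$. The action of $\mathrm{Aut}(X)$ on $X$ has exactly four orbits: $o_1=\{[l]\in X \mid l \text{ intersects two exceptional lines}\}$; $o_2=\{[l]\in X \mid l \text{ intersects only one exceptional line}\}$; $o_3=\{[l]\in X \mid l \text{ intersects } V \text{ but intersects none of } l_1,l_2,l_3\}$; $o_4=\{[l]\in X \mid l \text{ does not intersect } V\}$.
   Context: Everything is over $\mathbb{C}$. $\mathbb{G}(1,5)$ is embedded in $\mathbb{P}(\bigwedge^2\mathbb{C}^6)$ by the Plücker embedding; $[l]$ denotes the point corresponding to a line $l\subset\mathbb{P}^5$. Hyperplanes of $\mathbb{P}(\bigwedge^2\mathbb{C}^6)$ are identified with classes $\mathbb{P}(A)$ of nonzero antisymmetric $6\times6$ matrices $A$: the point $[\mathbb{P}(\mathrm{span}\{p,q\})]$ lies in the hyperplane $\mathbb{P}(A)^*$ if and only if $pA\,{}^tq=0$ ($p,q$ row vectors). A codimension-$2$ linear subspace $H^2$ is the intersection $\mathbb{P}(A)^*\cap\mathbb{P}(B)^*$ with $A,B$ linearly independent. $H^2$ is called general if there are exactly three distinct points $(\lambda_i:\mu_i)\in\mathbb{P}^1$, $i=1,2,3$, for which $\lambda_iA-\mu_iB$ has rank $\le4$.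 In this case each $\lambda_iA-\mu_iB$ has $2$-dimensional kernel and the lines $l_i=\mathbb{P}(\ker(\lambda_iA-\mu_iB))\subset\mathbb{P}^5$ are called the exceptional lines; they are pairwise disjoint and together span $\mathbb{P}^5$. For $j=1,2,3$, $V_j\subset\mathbb{P}^5$ is the $3$-plane spanned by the two lines $l_i$ with $i\neq j$, and $V=V_1\cup V_2\cup V_3$. By a known theorem (Piontkowski–Van de Ven), $\mathrm{Aut}(X)$ is identified with the subgroup of $\mathrm{PGL}(6,\mathbb{C})$ of those $\mathbb{P}(T)$ preserving $H^2$, i.e. such that ${}^tT^{-1}AT^{-1}$ and ${}^tT^{-1}BT^{-1}$ both lie in $\mathrm{span}\{A,B\}$; it acts on $X$ through its action on lines of $\mathbb{P}^5$. *)

(* Defs.v *)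
From mathcomp Require Import all_boot all_order all_algebra.
From mathcomp Require Import all_classical reals.
From mathcomp Require Import complex.

Set Implicit Arguments.
Unset Strict Implicit.
Unset Printing Implicit Defensive.

Import GRing.Theory.
Local Open Scope classical_set_scope.
Local Open Scope ring_scope.

(* A linear subspace P(U) of P^5 is represented by the vector subspace U of    *)
(* the space 'rV_6 of row vectors; lines are the subspaces with \dim U = 2.    *)
(* The definitions make sense over any field; the theorem is stated over the   *)
(* complex numbers R[i].                                                       *)
Section LinearSections.
Variable F : fieldType.
Local Notation subspace := {vspace 'rV[F]_6}.
Implicit Types (p q : 'rV[F]_6) (A B w T : 'M[F]_6) (l U W : subspace).

Definition antisym w : Prop := w^T = - w.

(* The exterior square of F^6 is modelled by antisymmetric matrices (F will    *)
(* have characteristic 0): the (i, j) entry of p /\ q is the Pluecker          *)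
(* coordinate p_i q_j - p_j q_i.                                               *)
Definition wedge p q : 'M[F]_6 := p^T *m q - q^T *m p.

(* The exterior square of l; for a line it is 1-dimensional and it is the      *)
(* point [l] of the projectivized exterior square of F^6.                      *)
Definition plucker l : {vspace 'M[F]_6} :=
  <<[seq wedge p q | p <- vbasis l, q <- vbasis l]>>%VS.

Definition G15 : set subspace := [set l | (\dim l = 2)%N].

Definition pairing A w : F := \sum_(i < 6) \sum_(j < 6 | (i < j)%N) A i j * w i j.

(* Affine cone over the hyperplane P(A)^*; see pairing_wedge below.            *)
Definition hyperplane A : set 'M[F]_6 :=
  [set w | antisym w /\ pairing A w = 0].

Definition H2 A B : set 'M[F]_6 := hyperplane A `&` hyperplane B.

Definition X A B : set subspace :=
  [set l | G15 l /\ [set` plucker l] `<=` H2 A B].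

(* H2 A B has codimension 2 and is general, and (lam i : mu i), i = 0, 1, 2,   *)
(* are the three distinct points of P^1 at which lam A - mu B degenerates.     *)
Definition general A B (lam mu : 'I_3 -> F) : Prop :=
  [/\ [/\ antisym A, antisym B & free [:: A; B]],
      forall i, (lam i, mu i) != (0, 0),
      forall i j, i != j -> lam i * mu j != lam j * mu i
    & forall x y : F, (x, y) != (0, 0) ->
        (\rank (x *: A - y *: B)%R <= 4)%N <->
        exists i, x * mu i = y * lam i].

Definition exc_line A B (lam mu : 'I_3 -> F) (i : 'I_3) : subspace :=
  lker (linfun (mulmxr (lam i *: A - mu i *: B))).

Definition V_ (L : 'I_3 -> subspace) (j : 'I_3) : subspace :=
  (\sum_(i | i != j) L i)%VS.

Definition meets U W : bool := (U :&: W != 0)%VS.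

Definition meets_V (L : 'I_3 -> subspace) l : Prop := exists j, meets l (V_ L j).

(* Representatives T of the elements P(T) of Aut(X), viewed inside PGL(6).     *)
Definition inAut A B T : Prop :=
  [/\ T \in unitmx,
      (invmx T)^T *m A *m invmx T \in <<[:: A; B]>>%VS
    & (invmx T)^T *m B *m invmx T \in <<[:: A; B]>>%VS].

(* T acts on points written as column vectors, hence by p |-> p *m T^T on row  *)
(* vectors; this is the action for which T sends the form A to                 *)
(* (invmx T)^T *m A *m invmx T.  Scalar matrices act trivially on subspaces,   *)
(* so only the class P(T) matters.                                             *)
Definition act T U : subspace := (linfun (mulmxr T^T) @: U)%VS.

Definition orbit A B l : set subspace :=
  [set l' | exists2 T, inAut A B T & l' = act T l].

Definition orbits A B : set (set subspace) := [set orbit A B l | l in X A B].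

Definition o1 A B (L : 'I_3 -> subspace) : set subspace :=
  [set l | X A B l /\ exists i j, [/\ i != j, meets l (L i) & meets l (L j)]].

Definition o2 A B (L : 'I_3 -> subspace) : set subspace :=
  [set l | X A B l /\ exists! i, meets l (L i)].

Definition o3 A B (L : 'I_3 -> subspace) : set subspace :=
  [set l | [/\ X A B l, meets_V L l & forall i, ~~ meets l (L i)]].

Definition o4 A B (L : 'I_3 -> subspace) : set subspace :=
  [set l | X A B l /\ ~ meets_V L l].

Lemma pairing_wedge A p q :
  antisym A -> (forall i, A i i = 0) ->
  (p *m A *m q^T) 0 0 = pairing A (wedge p q).
Proof.
move=> aA dA.
have -> : (p *m A *m q^T) 0 0 =
    \sum_(i < 6) \sum_(j < 6) A i j * (p 0 i * q 0 j).
  rewrite mxE exchange_big /=; apply: eq_bigr => j _.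
  rewrite !mxE mulr_suml; apply: eq_bigr => i _.
  by rewrite mulrCA mulrA.
have -> : \sum_(i < 6) \sum_(j < 6) A i j * (p 0 i * q 0 j) =
    \sum_(i < 6) \sum_(j < 6 | (i < j)%N) A i j * (p 0 i * q 0 j) +
    \sum_(i < 6) \sum_(j < 6 | (j < i)%N) A i j * (p 0 i * q 0 j).
  rewrite -big_split; apply: eq_bigr => i _ /=.
  rewrite (bigID (fun j : 'I_6 => (i < j)%N)) /=; congr (_ + _).
  rewrite (bigD1 i) ?ltnn //= dA mul0r add0r; apply: eq_bigl => j.
  by rewrite -leqNgt (ltn_neqAle j) andbC.
rewrite [X in _ + X](exchange_big_dep xpredT) //= -big_split; apply: eq_bigr => i _ /=.
rewrite -big_split; apply: eq_bigr => j _ /=.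
have -> : A j i = - A i j by have /matrixP/(_ i j) := aA; rewrite !mxE.
rewrite !mxE !big_ord1 !mxE mulrBr mulNr; congr (_ - _ * _).
exact: mulrC.
Qed.

End LinearSections.

(* Main.v *)
(* The kernels of the three degenerate members of the pencil span F^6 and are  *)
(* mutually orthogonal for every form of the pencil.  In suitable bases E i of *)
(* these kernels the pencil therefore becomes the set of block diagonal forms  *)
(* diag(w_0 J, w_1 J, w_2 J) with w_0 + w_1 + w_2 = 0; call such bases an      *)
(* adapted frame.  Any two adapted frames are exchanged by an automorphism,    *)
(* and automorphisms preserve adaptedness, so the lines that have a given      *)
(* coordinate matrix in some adapted frame form a single orbit.                *)
(*   A line with 2 x 2 coordinate blocks n_0, n_1, n_2 is in X iff the         *)
(* determinants of the blocks are equal.  Adapted frames may be changed by     *)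
(* elements of SL_2 in each block and by permutations of the blocks.  If the   *)
(* determinants are nonzero this reduces all n_i to the identity (o4);         *)
(* otherwise n_i = u_i e_0, and the proportionalities and vanishings among the *)
(* u_i, which record the exceptional lines met, leave the normal forms         *)
(* (f_0, f_1, 0), (f_0, f_1, f_1) and (f_0, f_1, f_0 + f_1) (o1, o2, o3).      *)

Require Import Defs.
From mathcomp Require Import all_boot all_order all_algebra.
From mathcomp Require Import all_classical reals.
From mathcomp Require Import complex.
From mathcomp Require Import fingroup perm ring.

Set Implicit Arguments.
Unset Strict Implicit.
Unset Printing Implicit Defensive.

Import GRing.Theory.
Local Open Scope classical_set_scope.
Local Open Scope ring_scope.

(** Scaling the three degenerate forms by the coefficients of the linear relation between their
    parameters gives antisymmetric [C i] of rank at most 4 with sum 0 and [C 0 - C 1] invertible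
    ([balanced_pencil]). The kernels of [C i] and [C j] are orthogonal for both of these forms,
    hence for the third. Since the kernels are also independent ([kernel_blocks_direct]), all forms
    become block diagonal at once, and rescaling the blocks yields an adapted frame
    ([adapted_exists]). Its three blocks span the exceptional lines, in some order
    ([exc_line_frame]).

    The transition between two adapted frames is an automorphism, so fixing the coordinates of a
    line and varying the frame sweeps out one orbit ([orbit_frame_class]). It remains to show that
    each of the four sets is such a frame class ([orbit_type_class]).

    On a line with basis [N], the form with weights w restricts to the sum of the w_i
    det([N *m D i]), times [J]. Hence the line is in X iff the three determinants agree ([X_frame]),
    and the j-th one vanishes iff the line meets V_j ([meets_VE]). So a line of X either avoids V,
    and unimodular block changes make all blocks the identity, or it meets all three V_j. In the
    second case it is encoded by three vectors u_i spanning the plane, up to a common element of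
    GL_2 and separate scalings, and it meets l_i iff the other two vectors are dependent
    ([meets_rk1]). Either one vector is zero, or all are nonzero and exactly two are proportional,
    or they are pairwise independent: these are o1, o2 and o3. *)

Lemma I3_ind (P : 'I_3 -> Prop) : P 0 -> P 1 -> P 2 -> forall i, P i.
Proof.
move=> P0 P1 P2 [[|[|[|//]]] lti].
- by rewrite (_ : Ordinal lti = 0) //; apply: val_inj.
- by rewrite (_ : Ordinal lti = 1) //; apply: val_inj.
- by rewrite (_ : Ordinal lti = 2) //; apply: val_inj.
Qed.

Lemma sumI3 (V : nmodType) (f : 'I_3 -> V) : \sum_i f i = f 0 + f 1 + f 2.
Proof.
rewrite !big_ord_recl big_ord0 addr0 addrA.
by congr (_ + f _ + f _); apply: val_inj.
Qed.

Lemma sumI2 (V : nmodType) (f : 'I_2 -> V) : \sum_i f i = f 0 + f 1.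
Proof.
by rewrite !big_ord_recl big_ord0 addr0; congr (_ + f _); apply: val_inj.
Qed.

Lemma I2_ind (P : 'I_2 -> Prop) : P 0 -> P 1 -> forall i, P i.
Proof.
move=> P0 P1 [[|[|//]] lti].
- by rewrite (_ : Ordinal lti = 0) //; apply: val_inj.
- by rewrite (_ : Ordinal lti = 1) //; apply: val_inj.
Qed.

(** * Antisymmetric matrices, free rows and the area form of the plane *)

Section LinearAlgebra.
Variable F : fieldType.

Lemma det_mx22 (M : 'M[F]_2) : \det M = M 0 0 * M 1 1 - M 0 1 * M 1 0.
Proof.
have l0 : lift (0 : 'I_2) (0 : 'I_1) = 1 by apply: val_inj.
have l1 : lift (1 : 'I_2) (0 : 'I_1) = 0 by apply: val_inj.
rewrite (expand_det_row M 0) sumI2 /cofactor !det_mx11 !mxE l0 l1.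
by rewrite expr0 (expr1 (-1)) mul1r mulN1r mulrN.
Qed.

(* W = Rb^T M Rb for a row basis Rb, with M antisymmetric and invertible of    *)
(* size \rank W.                                                               *)
Lemma antisym_rank_even n (W : 'M[F]_n) :
  (2 : F) != 0 -> W^T = - W -> ~~ odd (\rank W).
Proof.
move=> two0 aW; apply/negP => oddr.
have [S RS] := row_freeP (row_base_free W).
have WRb : (W <= row_base W)%MS by rewrite eq_row_base.
move: (row_base W) RS WRb => Rb RS WRb.
have [C WE] := submxP WRb.
have CE : C = Rb^T *m - (C^T *m S).
  have : Rb^T *m C^T = - (C *m Rb) by rewrite -trmx_mul -WE aW WE.
  move=> /(congr1 (mulmx^~ S)); rewrite mulNmx -!mulmxA RS mulmx1.
  by move=> /(congr1 -%R); rewrite opprK mulmxN.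
have WS : W *m S = C by have := congr1 (mulmx^~ S) WE; rewrite -mulmxA RS mulmx1.
have {}WE : W = Rb^T *m (S^T *m W *m S) *m Rb.
  apply: etrans WE _; congr (_ *m _).
  by rewrite -[S^T *m _ *m S]mulmxA WS CE [S^T *m _]mulmxA -trmx_mul RS trmx1 mul1mx.
set M := S^T *m W *m S in WE.
have aM : M^T = - M.
  by rewrite /M !trmx_mul trmxK aW mulNmx mulmxN mulmxA.
have rM : M \in unitmx.
  rewrite -row_free_unit -row_leq_rank.
  apply: leq_trans (leq_trans (mxrankM_maxl _ Rb) (mxrankM_maxr Rb^T M)).
  by rewrite -WE.
move: rM; rewrite unitmxE unitfE => /eqP; apply; apply/eqP.
have /eqP : \det M = - \det M.
  by rewrite -{1}det_tr aM -scaleN1r detZ -signr_odd oddr expr1 mulN1r.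
by rewrite -addr_eq0 -mulr2n -mulr_natl mulf_eq0 (negPf two0).
Qed.

Lemma antisym_unit6 (W : 'M[F]_6) :
  (2 : F) != 0 -> W^T = - W -> (4 < \rank W)%N -> W \in unitmx.
Proof.
move=> two0 aW r4; rewrite -row_free_unit -row_leq_rank.
have := antisym_rank_even two0 aW; have := rank_leq_row W.
by move: (\rank W) r4 => [|[|[|[|[|[|[|]]]]]]].
Qed.

Lemma sub_rank_row_free m n (U : 'M[F]_n) :
  (m <= \rank U)%N -> exists2 N : 'M[F]_(m, n), row_free N & (N <= U)%MS.
Proof.
move=> mU; exists (pid_mx m *m row_base U).
  by rewrite /row_free mxrankMfree ?row_base_free // rank_pid_mx.
by rewrite -(eq_row_base U) submxMl.
Qed.

Lemma row_free_mul0 m n (N : 'M[F]_(m, n)) (u : 'rV_m) :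
  row_free N -> u *m N = 0 -> u = 0.
Proof.
by move=> /row_freeP[M NM] /(congr1 (mulmx^~ M)); rewrite -mulmxA NM mulmx1 mul0mx.
Qed.

Lemma inj_row_free m n (N : 'M[F]_(m, n)) :
  (forall u : 'rV_m, u *m N = 0 -> u = 0) -> row_free N.
Proof.
move=> Ninj; rewrite -kermx_eq0; apply/eqP/row_matrixP => i.
by rewrite row0; apply: Ninj; rewrite -row_mul mulmx_ker row0.
Qed.

Definition J : 'M[F]_2 := delta_mx 0 1 - delta_mx 1 0.

(** The identity behind SL_2 = Sp_2: it allows unimodular changes inside each block, and it turns
    restrictions of forms to lines into determinants. *)
Lemma congrJ (M : 'M[F]_2) : M *m J *m M^T = \det M *: J.
Proof.
apply/matrixP => i j; rewrite det_mx22 !mxE sumI2 !mxE !sumI2 !mxE.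
by elim/I2_ind: i; elim/I2_ind: j; rewrite /= ?mulr0 ?mulr1 ?addr0; ring.
Qed.

Lemma J_neq0 : J != 0.
Proof.
by apply/eqP => /matrixP/(_ 0 1)/eqP; rewrite !mxE /= subr0 oner_eq0.
Qed.

Lemma J_unit : J \in unitmx.
Proof.
rewrite unitmxE det_mx22 !mxE /=.
by rewrite (_ : _ - _ = 1 :> F) ?unitr1 //; ring.
Qed.

Lemma antisym22 (M : 'M[F]_2) : (2 : F) != 0 -> M^T = - M -> M = M 0 1 *: J.
Proof.
move=> two0 /matrixP aM; have diag i : M i i = 0.
  apply/eqP; have /eqP := aM i i; rewrite !mxE -addr_eq0 -mulr2n -mulr_natl.
  by rewrite mulf_eq0 (negPf two0).
have := aM 1 0; rewrite !mxE => M10.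
apply/matrixP => i j; rewrite !mxE.
by elim/I2_ind: i; elim/I2_ind: j; rewrite /= ?diag ?M10 ?opprK; ring.
Qed.
End LinearAlgebra.

(** * Lines and the section X *)

Section Lines.
Variable F : fieldType.
Local Notation meets := (@Defs.meets F).
Implicit Types (A B W T : 'M[F]_6) (l U : {vspace 'rV[F]_6}).

Definition rowspan m (N : 'M[F]_(m, 6)) : {vspace 'rV[F]_6} :=
  (linfun (mulmxr N) @: fullv)%VS.

Lemma rowspanP m (N : 'M[F]_(m, 6)) v :
  reflect (exists u : 'rV_m, v = u *m N) (v \in rowspan N).
Proof.
apply: (iffP memv_imgP) => [[u _ ->] | [u ->]]; exists u; rewrite ?memvf //.
all: by rewrite lfunE.
Qed.

Lemma mem_row_rowspan m (N : 'M[F]_(m, 6)) u : u *m N \in rowspan N.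
Proof. by apply/rowspanP; exists u. Qed.

Lemma act_rowspan T m (N : 'M[F]_(m, 6)) :
  act T (rowspan N) = rowspan (N *m T^T).
Proof.
rewrite /act /rowspan -limg_comp; congr (_ @: _)%VS.
by apply/lfunP => u; rewrite comp_lfunE !lfunE /= mulmxA.
Qed.

Lemma rowspan_unit m (h : 'M[F]_m) (N : 'M[F]_(m, 6)) :
  h \in unitmx -> rowspan (h *m N) = rowspan N.
Proof.
move=> hu; apply/vspaceP => v; apply/rowspanP/rowspanP => -[u ->].
  by exists (u *m h); rewrite mulmxA.
by exists (u *m invmx h); rewrite mulmxA mulmxKV.
Qed.

Lemma dim_rowspan m (N : 'M[F]_(m, 6)) : row_free N -> \dim (rowspan N) = m.
Proof.
move=> Nfree; rewrite limg_dim_eq ?dimvf ?mul1n //=; first exact: mul1n.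
apply/eqP; rewrite -subv0; apply/subvP => u; rewrite memv_cap memvf memv_ker.
by rewrite lfunE memv0 => /eqP /(row_free_mul0 Nfree) ->.
Qed.

Lemma rowspan_ex l : exists2 N : 'M[F]_(\dim l, 6), row_free N & l = rowspan N.
Proof.
pose N : 'M[F]_(\dim l, 6) := \matrix_i (vbasis l)`_i.
have NE u : u *m N = \sum_i u 0 i *: (vbasis l)`_i.
  by rewrite mulmx_sum_row; apply: eq_bigr => i _; rewrite rowK.
exists N.
  apply: inj_row_free => u; rewrite NE => u0; apply/rowP => i; rewrite mxE.
  by have /freeP := basis_free (vbasisP l); apply.
apply/vspaceP => v; apply/idP/rowspanP => [vl | [u ->]].
  exists (\row_i coord (vbasis l) i v); rewrite NE {1}(coord_vbasis vl).
  by apply: eq_bigr => i _; rewrite mxE.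
rewrite NE memv_suml // => i _; rewrite memvZ // vbasis_mem // mem_nth //.
by rewrite size_tuple.
Qed.

Lemma meetsP U l :
  reflect (exists2 v, v != 0 & (v \in U) && (v \in l)) (meets U l).
Proof.
apply: (iffP idP) => [nz | [v vnz]].
  by exists (vpick (U :&: l)%VS); rewrite -?memv_cap ?memv_pick // vpick0.
rewrite -memv_cap; apply: contraTneq => ->.
by rewrite memv0.
Qed.

Lemma pairing_lin A n (c : 'I_n -> F) (w : 'I_n -> 'M[F]_6) :
  pairing A (\sum_k c k *: w k) = \sum_k c k * pairing A (w k).
Proof.
rewrite /pairing.
under [RHS]eq_bigr => k _ do rewrite mulr_sumr.
rewrite [RHS]exchange_big; apply: eq_bigr => i _ /=.
under [RHS]eq_bigr => k _ do rewrite mulr_sumr.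
rewrite [RHS]exchange_big; apply: eq_bigr => j _ /=.
rewrite summxE mulr_sumr; apply: eq_bigr => k _.
by rewrite mxE mulrCA.
Qed.

Lemma antisym_diag A i : (2 : F) != 0 -> antisym A -> A i i = 0.
Proof.
move=> two0 /matrixP/(_ i i)/eqP; rewrite !mxE -addr_eq0 -mulr2n -mulr_natl.
by rewrite mulf_eq0 (negPf two0) => /eqP.
Qed.

(** The pairing is linear and takes the value of the form A on wedge products, so both sides can be
    tested on a basis of [l]. *)
Lemma plucker_hyperplane A l : (2 : F) != 0 -> antisym A ->
  [set` plucker l] `<=` hyperplane A <->
  (forall p q, p \in l -> q \in l -> p *m A *m q^T = 0).
Proof.
move=> two0 aA; have pE := pairing_wedge _ _ aA (fun i => antisym_diag i two0 aA).
split=> [sub p q pl ql | zero].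
  rewrite (coord_vbasis pl) (coord_vbasis ql).
  rewrite mulmx_suml mulmx_suml big1 // => i _.
  rewrite linear_sum mulmx_sumr big1 // => j _.
  rewrite linearZ -!scalemxAl -scalemxAr.
  suff -> : (vbasis l)`_i *m A *m ((vbasis l)`_j)^T = 0 by rewrite !scaler0.
  apply/matrixP => a b; rewrite !ord1 pE mxE.
  have [] // := sub (wedge (vbasis l)`_i (vbasis l)`_j).
  by apply: memv_span; apply: allpairs_f; rewrite mem_nth // size_tuple.
rewrite /plucker; set Y := [seq _ | _ <- _, _ <- _] => w wY.
rewrite (@coord_span _ _ _ (in_tuple Y) _ wY) /=.
have Yk k : (k < size Y)%N -> exists p q, [/\ p \in l, q \in l & Y`_k = wedge p q].
  move=> /(mem_nth 0)/allpairsP[[p q] /= [pl ql ->]].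
  by exists p, q; rewrite !vbasis_mem.
split.
  apply/matrixP => i j; rewrite !(mxE, summxE) -sumrN; apply: eq_bigr => k _.
  have [p [q [_ _ ->]]] := Yk k (ltn_ord k).
  by rewrite !mxE !big_ord1 !mxE; ring.
rewrite (pairing_lin A (fun k => coord (in_tuple Y) k w)) big1 // => k _.
have [p [q [pl ql ->]]] := Yk k (ltn_ord k).
by rewrite -pE zero // mxE mulr0.
Qed.

Lemma X_P A B (N : 'M[F]_(2, 6)) :
  (2 : F) != 0 -> antisym A -> antisym B -> row_free N ->
  X A B (rowspan N) <-> N *m A *m N^T = 0 /\ N *m B *m N^T = 0.
Proof.
move=> two0 aA aB Nfree.
have equiv W : (forall p q, p \in rowspan N -> q \in rowspan N ->
    p *m W *m q^T = 0) <-> N *m W *m N^T = 0.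
  have expand (u v : 'rV_2) :
      u *m N *m W *m (v *m N)^T = u *m (N *m W *m N^T) *m v^T.
    by rewrite trmx_mul !mulmxA.
  split=> [zero | zero p q /rowspanP[u ->] /rowspanP[v ->]]; last first.
    by rewrite expand zero mulmx0 mul0mx.
  apply/matrixP => i j.
  have := zero _ _ (mem_row_rowspan N (delta_mx 0 i)) (mem_row_rowspan N (delta_mx 0 j)).
  rewrite expand => /matrixP/(_ 0 0).
  by rewrite trmx_delta -rowE -colE !mxE.
rewrite -!equiv -!plucker_hyperplane //; split=> [[_ sub] | [sA sB]].
  by split=> w /sub [].
split; first by rewrite /G15 /= dim_rowspan.
by move=> w wl; split; [exact: sA | exact: sB].
Qed.

End Lines.

(** * Frames adapted to a pencil *)

Section Frames.
Variable F : fieldType.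
Implicit Types (W T : 'M[F]_6) (E : 'I_3 -> 'M[F]_(2, 6)) (D : 'I_3 -> 'M[F]_(6, 2)).
Variables A B : 'M[F]_6.
Local Notation pencil := <<[:: A; B]>>%VS.

(** The pullback of the area form [J] along the coordinate map v |-> v *m D. *)
Definition omega (D : 'M[F]_(6, 2)) : 'M[F]_6 := D *m J F *m D^T.

(* In the basis of F^6 formed by the rows of the E i, with coordinate maps     *)
(* v |-> v *m D i, the pencil consists of the block diagonal matrices          *)
(* diag(w_0 J, w_1 J, w_2 J) with w_0 + w_1 + w_2 = 0.                         *)
Definition adapted E D : Prop :=
  [/\ forall i j, E i *m D j = (i == j)%:R%:M,
      \sum_i D i *m E i = 1%:M
    & forall W, W \in pencil <->
        exists2 w : 'I_3 -> F, \sum_i w i = 0 & W = \sum_i w i *: omega (D i)].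

Definition frame_class (c : 'I_3 -> 'M[F]_2) : set {vspace 'rV[F]_6} :=
  [set l | exists E D, adapted E D /\ l = rowspan (\sum_i c i *m E i)].

Lemma adapted_mulED E D i j : adapted E D -> E i *m D j = if i == j then 1%:M else 0.
Proof. by case=> -> _ _; case: eqP => //= _; rewrite -scalemx1 scale0r. Qed.

Lemma adapted_sumED E D m (n : 'I_3 -> 'M[F]_(m, 2)) j :
  adapted E D -> (\sum_i n i *m E i) *m D j = n j.
Proof.
move=> fED; rewrite mulmx_suml (bigD1 j) //= big1 ?addr0 => [|i /negPf ij].
  by rewrite -mulmxA (adapted_mulED _ _ fED) eqxx mulmx1.
by rewrite -mulmxA (adapted_mulED _ _ fED) ij mulmx0.
Qed.

Lemma adapted_decomp E D m (N : 'M[F]_(m, 6)) :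
  adapted E D -> N = \sum_i N *m D i *m E i.
Proof.
case=> _ DE1 _; rewrite -{1}[N]mulmx1 -DE1 mulmx_sumr.
by apply: eq_bigr => i _; rewrite mulmxA.
Qed.

(** [inAut] asks only that congruence by the inverse of T map the pencil into itself. This map is
    injective, so by dimension it is onto, and congruence by T preserves the pencil too. *)
Lemma inAut_pencil T : inAut A B T ->
  forall W, W \in pencil <-> T^T *m W *m T \in pencil.
Proof.
case=> Tu sA sB; set S := (invmx T)^T in sA sB.
have ST : S *m T^T = 1%:M by rewrite -trmx_mul mulmxV ?trmx1.
have TS : T^T *m S = 1%:M by rewrite -trmx_mul mulVmx ?trmx1.
pose phi : 'End('M[F]_6) := linfun (mulmxr (invmx T) \o mulmx S).
have phiE W : phi W = S *m W *m invmx T by rewrite lfunE.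
have TphiT W : T^T *m phi W *m T = W.
  by rewrite phiE !mulmxA TS mul1mx mulmxKV.
have phiTT W : phi (T^T *m W *m T) = W.
  by rewrite phiE !mulmxA ST mul1mx mulmxK.
have phiU : (phi @: pencil)%VS = pencil.
  apply/eqP; rewrite eqEdim limg_dim_eq ?leqnn ?andbT.
    rewrite limg_span; apply/span_subvP => W.
    by rewrite !inE => /orP[] /eqP ->; rewrite phiE.
  apply/eqP; rewrite -subv0; apply/subvP => W; rewrite memv_cap memv_ker memv0.
  by move=> /andP[_ /eqP W0]; rewrite -[W]TphiT W0 mulmx0 mul0mx.
move=> W; split=> [|WU].
  by rewrite -{1}phiU => /memv_imgP[V VU ->]; rewrite TphiT.
by rewrite -[W]phiTT -phiU memv_img.
Qed.

Lemma omega_congr (S : 'M[F]_6) (D : 'M[F]_(6, 2)) :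
  omega (S *m D) = S *m omega D *m S^T.
Proof. by rewrite /omega trmx_mul !mulmxA. Qed.

Lemma omega_mulr (D : 'M[F]_(6, 2)) (g : 'M[F]_2) :
  omega (D *m g) = \det g *: omega D.
Proof.
rewrite /omega trmx_mul -!mulmxA [g *m _]mulmxA [g *m _ *m _]mulmxA congrJ.
by rewrite -!(scalemxAl, scalemxAr) !mulmxA.
Qed.

Lemma adapted_act E D T : adapted E D -> inAut A B T ->
  adapted (fun i => E i *m T^T) (fun i => invmx T^T *m D i).
Proof.
move=> [ED DE span] aT; have Tu : T^T \in unitmx by rewrite unitmx_tr; case: aT.
split=> [i j||W]; first by rewrite !mulmxA mulmxK.
  rewrite -(mulVmx Tu) -[in RHS](mulmx1 (invmx _)) -DE mulmx_sumr mulmx_suml.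
  by apply: eq_bigr => i _; rewrite !mulmxA.
rewrite (inAut_pencil aT) span.
have STE V : invmx T^T *m (T^T *m V *m T) *m (invmx T^T)^T = V.
  by rewrite !mulmxA mulVmx // mul1mx -trmx_inv trmxK mulmxK // -unitmx_tr.
split=> -[w w0 WE]; exists w => //.
  rewrite -[W]STE WE mulmx_sumr mulmx_suml; apply: eq_bigr => i _.
  by rewrite omega_congr -scalemxAr -scalemxAl.
rewrite WE mulmx_sumr mulmx_suml; apply: eq_bigr => i _.
rewrite omega_congr -scalemxAr -scalemxAl !mulmxA mulmxV // mul1mx.
by rewrite -trmx_inv trmxK mulmxKV // -unitmx_tr.
Qed.

(** Right multiplication by the sum keeps the coordinates and replaces the frame [E] by [E']. The
    transpose compensates for the one in [act]. *)
Lemma adapted_inAut E D E' D' : adapted E D -> adapted E' D' ->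
  inAut A B (\sum_i D i *m E' i)^T.
Proof.
move=> fED fED'; have [ED DE span] := fED; have [ED' DE' span'] := fED'.
set P := \sum_i _; set P' := \sum_i D' i *m E i.
have PP' : P *m P' = 1%:M.
  rewrite mulmx_sumr -DE; apply: eq_bigr => i _.
  by rewrite mulmxA /P (adapted_sumED _ _ fED').
have Pu : P \in unitmx by have [] := mulmx1_unit PP'.
have invP : invmx P = P' by rewrite -[RHS](mulKmx Pu) PP' mulmx1.
have pencilP' W : W \in pencil -> P' *m W *m P'^T \in pencil.
  move=> /span[w w0 ->]; apply/span'; exists w => //.
  rewrite mulmx_sumr mulmx_suml; apply: eq_bigr => i _.
  by rewrite -scalemxAr -scalemxAl -omega_congr /P' (adapted_sumED _ _ fED).
by split; rewrite ?unitmx_tr // -trmx_inv trmxK invP pencilP' // memv_span //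
  !inE eqxx ?orbT.
Qed.

Lemma adapted_change E D (g : 'I_3 -> 'M[F]_2) : (forall i, \det (g i) = 1) ->
  adapted E D -> adapted (fun i => g i *m E i) (fun i => D i *m invmx (g i)).
Proof.
move=> g1 fED; have [ED DE span] := fED.
have gu i : g i \in unitmx by rewrite unitmxE g1 unitr1.
split=> [i j||W].
- rewrite mulmxA -[g i *m _ *m _]mulmxA (adapted_mulED _ _ fED).
  case: eqVneq => [->|_]; first by rewrite mulmx1 mulmxV.
  by rewrite mulmx0 mul0mx -scalemx1 scale0r.
- by rewrite -DE; apply: eq_bigr => i _; rewrite mulmxA mulmxKV.
rewrite span; split=> -[w w0 ->]; exists w => //; apply: eq_bigr => i _.
all: by rewrite omega_mulr det_inv g1 invr1 scale1r.
Qed.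

Lemma adapted_perm E D (s : {perm 'I_3}) : adapted E D ->
  adapted (fun i => E (s i)) (fun i => D (s i)).
Proof.
move=> [ED DE span]; split=> [i j||W].
- by rewrite ED (inj_eq (@perm_inj _ s)).
- by rewrite -DE [RHS](reindex_inj (@perm_inj _ s)).
rewrite span; split=> -[w w0 ->].
  exists (fun i => w (s i)); first by rewrite -[in RHS]w0 [RHS](reindex_inj (@perm_inj _ s)).
  by rewrite [LHS](reindex_inj (@perm_inj _ s)).
exists (fun i => w ((s^-1)%g i)).
  by rewrite -[in RHS]w0 [LHS](reindex_inj (@perm_inj _ s));
    apply: eq_bigr => i _; rewrite permK.
by rewrite [RHS](reindex_inj (@perm_inj _ s)); apply: eq_bigr => i _; rewrite permK.
Qed.

(** Automorphisms carry adapted frames to adapted frames without changing coordinates, and any two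
    adapted frames are related in this way. *)
Lemma orbit_frame_class c l : frame_class c l -> Defs.orbit A B l = frame_class c.
Proof.
move=> [E [D [fED ->]]]; apply/seteqP; split=> l'.
  move=> [T aT ->]; do 2!eexists; split; first exact: adapted_act fED aT.
  rewrite act_rowspan mulmx_suml; congr rowspan.
  by apply: eq_bigr => i _; rewrite mulmxA.
move=> [E' [D' [fED' ->]]]; exists (\sum_i D i *m E' i)^T.
  exact: adapted_inAut fED fED'.
rewrite act_rowspan trmxK; congr rowspan.
rewrite mulmx_sumr; apply: eq_bigr => i _.
by rewrite mulmxA (adapted_sumED _ _ fED).
Qed.

End Frames.

(** * Existence of adapted frames *)

Section Existence.
Variable F : fieldType.
Hypothesis two0 : (2 : F) != 0.

Lemma span2P (V : vectType F) (a b v : V) :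
  v \in <<[:: a; b]>>%VS <-> exists x y, v = x *: a + y *: b.
Proof.
rewrite span_cons span_seq1; split=> [/memv_addP[_ /vlineP[x ->]]|[x [y ->]]].
  by move=> [_ /vlineP[y ->] ->]; exists x, y.
by rewrite memv_add // memvZ // memv_line.
Qed.

(* The weights d i are the coefficients of the linear relation between the      *)
(* three points (lam i, mu i) of F^2.                                          *)
Lemma balanced_pencil (A B : 'M[F]_6) lam mu : general A B lam mu ->
  exists C : 'I_3 -> 'M[F]_6,
  [/\ forall i, antisym (C i) /\ (\rank (C i) <= 4)%N, \sum_i C i = 0,
      C 0 - C 1 \in unitmx & <<[:: A; B]>>%VS = <<[:: C 0%R; C 1%R]>>%VS].
Proof.
move=> [[aA aB fAB] nz dist rk4].
pose d i := lam (i + 1) * mu (i + 2) - lam (i + 2) * mu (i + 1).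
have d0 : d 0 = lam 1 * mu 2 - lam 2 * mu 1.
  by rewrite /d; congr (lam _ * mu _ - lam _ * mu _); apply: val_inj.
have d1 : d 1 = lam 2 * mu 0 - lam 0 * mu 2.
  by rewrite /d; congr (lam _ * mu _ - lam _ * mu _); apply: val_inj.
have d2 : d 2 = lam 0 * mu 1 - lam 1 * mu 0.
  by rewrite /d; congr (lam _ * mu _ - lam _ * mu _); apply: val_inj.
have dnz i : d i != 0.
  by rewrite subr_eq0; elim/I3_ind: i; apply: dist.
have antisym_comb x y : antisym (x *: A - y *: B).
  by rewrite /antisym linearB !linearZ /= aA aB !scalerN opprB opprK addrC.
exists (fun i => d i *: (lam i *: A - mu i *: B)); split.
- move=> i; split; first by rewrite /antisym linearZ /= antisym_comb scalerN.
  by rewrite mxrank_scale_nz // rk4 //; exists i; rewrite mulrC.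
- rewrite sumI3 d0 d1 d2; apply/matrixP => i j; rewrite !mxE; ring.
- set x := d 0 * lam 0 - d 1 * lam 1; set y := d 0 * mu 0 - d 1 * mu 1.
  have -> : d 0 *: (lam 0 *: A - mu 0 *: B) - d 1 *: (lam 1 *: A - mu 1 *: B)
      = x *: A - y *: B.
    by apply/matrixP => i j; rewrite !mxE /x /y; ring.
  (* The parameter (x : y) of [C 0 - C 1] differs from the three degenerate ones. Against the third
     point the determinant is -2 d_0 d_1, where characteristic 2 must be excluded. *)
  have nprop i : x * mu i != y * lam i.
    rewrite -subr_eq0 /x /y; elim/I3_ind: i.
    + by rewrite (_ : _ - _ = d 1 * d 2) ?mulf_neq0 // d2; ring.
    + by rewrite (_ : _ - _ = d 0 * d 2) ?mulf_neq0 // d2; ring.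
    + by rewrite (_ : _ - _ = - (2 * d 0 * d 1)) ?oppr_eq0 ?mulf_neq0 // d0 d1; ring.
  apply: antisym_unit6 => //; first exact: antisym_comb.
  rewrite ltnNge; apply/negP; rewrite rk4 => [[i /eqP]|]; first exact/negP/nprop.
  by apply: contraNneq (nprop 0) => -[-> ->]; rewrite !mul0r.
apply/eqP; rewrite eqEsubv; apply/andP; split; apply/span_subvP => W.
  rewrite !inE => /orP[] /eqP ->; apply/span2P.
    (* Cramer's rule: [C 0] and [C 1] are [d 0] and [d 1] times combinations of A and B whose
       coefficient determinant is, up to sign, [d 2]. *)
    exists (mu 1 / (d 0 * d 2)), (- (mu 0 / (d 1 * d 2))).
    apply/matrixP => i j; rewrite !mxE.
    have := dnz 2; have := dnz 1; have := dnz 0; set c0 := d 0; set c1 := d 1.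
    by rewrite d2 => *; field; apply/and3P; split.
  exists (lam 1 / (d 0 * d 2)), (- (lam 0 / (d 1 * d 2))).
  apply/matrixP => i j; rewrite !mxE.
  have := dnz 2; have := dnz 1; have := dnz 0; set c0 := d 0; set c1 := d 1.
  by rewrite d2 => *; field; apply/and3P; split.
by rewrite !inE => /orP[] /eqP ->; rewrite memvZ // memvB // memvZ // memv_span //
  !inE eqxx ?orbT.
Qed.

Definition dil (s : F) : 'M[F]_2 :=
  \matrix_(i, j) if i == j then (if i == 0 then s else 1) else 0.

Lemma det_dil s : \det (dil s) = s.
Proof. by rewrite det_mx22 !mxE /= mulr1 mulr0 subr0. Qed.

Lemma dil_unit s : s != 0 -> dil s \in unitmx.
Proof. by rewrite unitmxE det_dil unitfE. Qed.

(** Selects the coordinates 2i and 2i+1, splitting F^6 into three planes. *)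
Definition sel (i : 'I_3) : 'M[F]_(2, 6) :=
  \matrix_(s, k) ((k : nat) == 2 * i + s)%N%:R.

Lemma mul_sel i j : sel i *m (sel j)^T = (i == j)%:R%:M.
Proof.
have lt6 (k : 'I_3) (s : 'I_2) : (2 * k + s < 6)%N by elim/I3_ind: k; elim/I2_ind: s.
apply/matrixP => s t; rewrite !mxE (bigD1 (Ordinal (lt6 i s))) //= !mxE eqxx mul1r.
rewrite big1 ?addr0 => [|k kn]; last first.
  by rewrite !mxE (negPf (_ : (k : nat) != 2 * i + s)%N) ?mul0r.
by elim/I3_ind: i; elim/I3_ind: j; elim/I2_ind: s; elim/I2_ind: t.
Qed.

Lemma sum_sel : \sum_i (sel i)^T *m sel i = 1%:M.
Proof.
apply/matrixP => k l; rewrite sumI3 !mxE !sumI2 !mxE /=.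
case: k l => [[|[|[|[|[|[|//]]]]]] ltk] [[|[|[|[|[|[|//]]]]]] ltl];
by rewrite /= ?mul0r ?mulr0 ?mulr1 ?addr0 ?add0r.
Qed.

(** Independence makes the 6 x 6 matrix stacked from the [N i] invertible; the [D i] are the column
    blocks of its inverse. *)
Lemma stack_frame (N : 'I_3 -> 'M[F]_(2, 6)) :
  (forall u : 'I_3 -> 'rV_2, \sum_i u i *m N i = 0 -> forall i, u i = 0) ->
  exists D : 'I_3 -> 'M[F]_(6, 2),
    (forall i j, N i *m D j = (i == j)%:R%:M) /\ \sum_i D i *m N i = 1%:M.
Proof.
move=> direct; pose P := \sum_i (sel i)^T *m N i.
have selP i : sel i *m P = N i.
  rewrite mulmx_sumr (bigD1 i) //= big1 ?addr0 => [|j /negPf ji].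
    by rewrite mulmxA mul_sel eqxx mul1mx.
  by rewrite mulmxA mul_sel eq_sym ji -scalemx1 scale0r mul0mx.
have Pu : P \in unitmx.
  rewrite -row_free_unit; apply: inj_row_free => u uP.
  rewrite -[u]mulmx1 -sum_sel mulmx_sumr big1 // => i _; rewrite mulmxA.
  rewrite (direct (fun i => u *m (sel i)^T)) ?mul0mx // -[RHS]uP mulmx_sumr.
  by apply: eq_bigr => k _; rewrite mulmxA.
exists (fun i => invmx P *m (sel i)^T); split=> [i j|].
  by rewrite -selP -mulmxA mulKVmx // mul_sel.
rewrite -(mulVmx Pu) mulmx_sumr; apply: eq_bigr => i _.
by rewrite mulmxA.
Qed.
End Existence.

(** * Block diagonal normal form of the pencil *)

Section Normal.
Variable F : fieldType.
Hypothesis two0 : (2 : F) != 0.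

(** Let v_i in ker C_i have sum 0. The relations on the v_i and on the C_i express every product v_i
    C_j as 0 or plus or minus a = v_1 C_0. Thus (v_0 - v_1)(C_0 - C_1) = 0, so v_0 = v_1 and a = v_0
    C_0 = 0; then every v_i is killed by the invertible C_0 - C_1. *)
Lemma kernel_blocks_direct (C : 'I_3 -> 'M[F]_6) (N : 'I_3 -> 'M[F]_(2, 6)) :
  \sum_i C i = 0 -> C 0 - C 1 \in unitmx ->
  (forall i, row_free (N i)) -> (forall i, N i *m C i = 0) ->
  forall u : 'I_3 -> 'rV_2, \sum_i u i *m N i = 0 -> forall i, u i = 0.
Proof.
move=> sC Wu Nfree NC u; pose v i := u i *m N i; rewrite -/(\sum_i v i) => sv.
have vC i : v i *m C i = 0 by rewrite -mulmxA NC mulmx0.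
have vsC i : v i *m C 0 + v i *m C 1 + v i *m C 2 = 0.
  by rewrite -!mulmxDr -sumI3 sC mulmx0.
have svC i : v 0 *m C i + v 1 *m C i + v 2 *m C i = 0.
  by rewrite -!mulmxDl -sumI3 sv mul0mx.
pose a := v 1 *m C 0.
have a20 : v 2 *m C 0 = - a.
  by apply/eqP; rewrite -addr_eq0 addrC -(svC 0) vC add0r.
have a21 : v 2 *m C 1 = a.
  by apply/eqP; rewrite -subr_eq0 -(vsC 2) vC addr0 a20 addrC.
have a01 : v 0 *m C 1 = - a.
  by apply/eqP; rewrite -addr_eq0 -(svC 1) vC addr0 a21.
have Winj w : w *m (C 0 - C 1) = 0 -> w = 0.
  by move=> /(congr1 (mulmx^~ (invmx (C 0 - C 1)))); rewrite mulmxK // mul0mx.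
have v01 : v 0 = v 1.
  apply/eqP; rewrite -subr_eq0; apply/eqP/Winj.
  by rewrite mulmxBl !mulmxBr !vC a01 -/a subr0 sub0r opprK subrr.
have a0 : a = 0 by rewrite /a -v01 vC.
move=> i; apply: row_free_mul0 (Nfree i) _; rewrite -/(v i); apply: Winj.
rewrite mulmxBr.
elim/I3_ind: i.
- by rewrite vC a01 a0 oppr0 subr0.
- by rewrite vC -/a a0 subr0.
- by rewrite a20 a21 a0 oppr0 addr0.
Qed.

Lemma adapted_exists (A B : 'M[F]_6) lam mu :
  general A B lam mu -> exists E D, adapted A B E D.
Proof.
move=> /(balanced_pencil two0)[C [Cprop sC Wu pencilE]].
have aC i : (C i)^T = - C i by case: (Cprop i).
have /fin_all_exists[N Nprop] i : exists N : 'M[F]_(2, 6), row_free N /\ N *m C i = 0.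
  have [|N Nf /submxP[M NE]] := @sub_rank_row_free _ 2 _ (kermx (C i)).
    rewrite mxrank_ker; have [_] := Cprop i.
    by move: (\rank _) => [|[|[|[|[]]]]].
  by exists N; split=> //; rewrite NE -mulmxA mulmx_ker mulmx0.
have Nfree i : row_free (N i) by case: (Nprop i).
have NC i : N i *m C i = 0 by case: (Nprop i).
have [P [NP PN]] := stack_frame (kernel_blocks_direct sC Wu Nfree NC).
have CN i : C i *m (N i)^T = 0.
  by rewrite -[C i]opprK -aC mulNmx -trmx_mul NC trmx0 oppr0.
(* Distinct kernels are orthogonal: immediate for k = i or k = j, and for the remaining k because
   the three forms sum to 0. *)
have NCN i j k : i != j -> N i *m C k *m (N j)^T = 0.
  move=> ij; have [->|ki] := eqVneq k i; first by rewrite NC mul0mx.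
  have [->|kj] := eqVneq k j; first by rewrite -mulmxA CN mulmx0.
  have := congr1 (fun X => N i *m X *m (N j)^T) sC.
  rewrite mulmx0 mul0mx mulmx_sumr mulmx_suml (bigD1 k) //= big1 ?addr0 // => h.
  have [-> _|hi] := eqVneq h i; first by rewrite NC mul0mx.
  have [-> _|hj] := eqVneq h j; first by rewrite -mulmxA CN mulmx0.
  by move: i j k h ij ki kj hi hj; do 4![elim/I3_ind].
pose m k i := (N i *m C k *m (N i)^T) 0 1.
have mE k i : N i *m C k *m (N i)^T = m k i *: J F.
  by apply: antisym22 => //; rewrite !trmx_mul trmxK aC mulNmx mulmxN mulmxA.
have CE k : C k = \sum_i m k i *: omega (P i).
  rewrite -[C k]mul1mx -[_ *m C k]mulmx1 -{2}trmx1 -PN linear_sum mulmx_suml.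
  rewrite mulmx_suml; apply: eq_bigr => i _.
  rewrite mulmx_sumr (bigD1 i) //= big1 ?addr0 => [|j ji].
    rewrite trmx_mul !mulmxA -[_ *m N i *m _]mulmxA -[_ *m (N i *m _) *m _]mulmxA mE.
    by rewrite -scalemxAr -scalemxAl.
  rewrite trmx_mul !mulmxA -[_ *m N i *m _]mulmxA -[_ *m (N i *m _) *m _]mulmxA.
  by rewrite NCN ?mulmx0 ?mul0mx // eq_sym.
have mii i : m i i = 0 by rewrite /m NC mul0mx mxE.
have sm i : m 0 i + m 1 i + m 2 i = 0.
  have := congr1 (fun X => (N i *m X *m (N i)^T) 0 1) sC.
  rewrite mulmx0 mul0mx [RHS]mxE => <-.
  by rewrite sumI3 !mulmxDr !mulmxDl [RHS]mxE [in RHS]mxE.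
have nzW i : m 0 i - m 1 i != 0.
  apply: contraTneq (Nfree i) => mW0.
  have : N i *m (C 0 - C 1) = 0.
    rewrite mulmxBr !CE !mulmx_sumr -sumrB (bigD1 i) //= big1 ?addr0 => [|j /negPf ji].
      by rewrite -!scalemxAr -scalerBl mW0 scale0r.
    rewrite -!scalemxAr -scalerBl /omega !mulmxA NP eq_sym ji.
    by rewrite -scalemx1 scale0r !mul0mx scaler0.
  move=> /(congr1 (mulmx^~ (invmx (C 0 - C 1)))); rewrite mulmxK // mul0mx => ->.
  by rewrite /row_free mxrank0.
(* By [mii] and [sm], block i carries the coefficient 0 in C_i and opposite coefficients in the
   other two forms; [s i] is one of this pair. Rescaling block i by [s i] makes all coefficients 0,
   1 or -1, so that [C 0] and [C 1] span the forms of weight sum 0. *)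
pose s : 'I_3 -> F := fun i => [:: m 1 0; m 2 1; m 0 2]`_i.
have m21 : m 2 1 = - m 0 1 by apply/eqP; rewrite -addr_eq0 addrC -(sm 1) mii addr0.
have m20 : m 2 0 = - m 1 0 by apply/eqP; rewrite -addr_eq0 addrC -(sm 0) mii add0r.
have m12 : m 1 2 = - m 0 2 by apply/eqP; rewrite -addr_eq0 addrC -(sm 2) mii addr0.
have snz i : s i != 0.
  elim/I3_ind: i; rewrite /s /=.
  - by have := nzW 0; rewrite mii sub0r oppr_eq0.
  - by rewrite m21 oppr_eq0; have := nzW 1; rewrite mii subr0.
  - by have := nzW 2; rewrite m12 opprK -mulr2n -(mulr_natl (m 0 2)) mulf_eq0 negb_or
      => /andP[].
pose D i := P i *m invmx (dil (s i)^-1).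
have omegaP i : omega (P i) = (s i)^-1 *: omega (D i).
  by rewrite omega_mulr det_inv det_dil invrK scalerA mulVf ?scale1r.
have C0E : C 0 = omega (D 2) - omega (D 1).
  rewrite CE sumI3 mii scale0r add0r !omegaP !scalerA addrC /s /= mulfV ?(snz 2) //.
  rewrite m21 invrN mulrN mulfV ?scaleN1r ?scale1r //.
  by have := snz 1; rewrite /s /= m21 oppr_eq0.
have C1E : C 1 = omega (D 0) - omega (D 2).
  rewrite CE sumI3 mii scale0r addr0 !omegaP !scalerA /s /= mulfV ?(snz 0) //.
  by rewrite m12 mulNr mulfV ?(snz 2) // scaleN1r scale1r.
exists (fun i => dil (s i)^-1 *m N i), D.
have du i : dil (s i)^-1 \in unitmx by rewrite dil_unit ?invr_eq0.
split=> [i j||W].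
- rewrite mulmxA -[_ *m N i *m _]mulmxA NP.
  case: eqVneq => [->|_]; first by rewrite mulmx1 mulmxV.
  by rewrite -scalemx1 scale0r mulmx0 mul0mx.
- by rewrite -PN; apply: eq_bigr => i _; rewrite mulmxA mulmxKV.
rewrite pencilE C0E C1E; split.
  move=> /span2P[x [y ->]]; exists (fun i => [:: y; - x; x - y]`_i).
    by rewrite sumI3 /=; ring.
  by rewrite sumI3 /=; apply/matrixP => i j; rewrite !mxE; ring.
move=> [w]; rewrite !sumI3 => /eqP; rewrite addr_eq0 => /eqP w2 ->.
apply/span2P; exists (- w 1), (w 0).
have -> : w 2 = - (w 0 + w 1) by rewrite w2 opprK.
by apply/matrixP => i j; rewrite !mxE; ring.
Qed.

(** The form with weights 1 and -1 on the two blocks other than i has kernel exactly the span of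
    [E i] and rank at most 4, so it is proportional to a degenerate member. Distinct blocks have
    distinct spans, so the matching is a permutation. *)
Lemma exc_line_frame (A B : 'M[F]_6) lam mu E D :
  general A B lam mu -> adapted A B E D ->
  exists s : {perm 'I_3}, forall i, exc_line A B lam mu (s i) = rowspan (E i).
Proof.
move=> [_ nz _ rk4] fED; have [ED DE span] := fED.
have mem_E i v : v \in rowspan (E i) <-> v *m D (i + 1) = 0 /\ v *m D (i + 2) = 0.
  split=> [/rowspanP[u ->]|[v1 v2]].
    rewrite -!mulmxA !(adapted_mulED _ _ fED).
    by elim/I3_ind: i; rewrite mulmx0.
  rewrite (adapted_decomp v fED) (bigD1 i) //= big1 ?addr0 ?mem_row_rowspan // => j ji.
  suff -> : v *m D j = 0 by rewrite mul0mx.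
  suff : j = i + 1 \/ j = i + 2 by case=> ->.
  move: j ji {v1 v2}; elim/I3_ind: i; elim/I3_ind => //= _;
    by [left; apply: val_inj | right; apply: val_inj].
have Einj i j : rowspan (E i) = rowspan (E j) -> i = j.
  move=> Eij; apply/eqP; apply: contraT => /negPf ij.
  have /rowspanP[u uE] : delta_mx 0 0 *m E i \in rowspan (E j).
    by rewrite -Eij mem_row_rowspan.
  move/(congr1 (mulmx^~ (D i))): uE.
  rewrite -!mulmxA !(adapted_mulED _ _ fED) eqxx eq_sym ij mulmx1 mulmx0.
  by move=> /matrixP/(_ 0 0)/eqP; rewrite !mxE oner_eq0.
have /fin_all_exists[s sE] i : exists k, exc_line A B lam mu k = rowspan (E i).
  pose W := omega (D (i + 1)) - omega (D (i + 2)).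
  have i12 : (i + 1 == i + 2) = false by elim/I3_ind: i @W.
  have /span2P[x [y0 WE]] : W \in <<[:: A; B]>>%VS.
    apply/span; exists (fun k => (k == i + 1)%:R - (k == i + 2)%:R).
      by rewrite sumI3; elim/I3_ind: i {W i12}; rewrite /=; ring.
    rewrite (bigD1 (i + 1)) //= (bigD1 (i + 2)) //=; last by rewrite eq_sym i12.
    rewrite big1 ?addr0 => [|k /andP[/negPf -> /negPf ->]]; last by rewrite subrr scale0r.
    by rewrite !eqxx i12 eq_sym i12 subr0 sub0r scale1r scaleN1r.
  pose y := - y0; have {}WE : W = x *: A - y *: B by rewrite scaleNr opprK.
  have vW (v : 'rV_6) : v *m W = 0 <-> v \in rowspan (E i).
    rewrite mem_E /W; split=> [|[v1 v2]]; last first.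
      by rewrite mulmxBr /omega !mulmxA v1 v2 !mul0mx subrr.
    move=> vW0; have DE0 j k : (D j)^T *m (E k)^T = (k == j)%:R%:M.
      by rewrite -trmx_mul ED tr_scalar_mx.
    have cancelJ (a : 'rV[F]_2) : a *m J F = 0 -> a = 0.
      by move=> /(congr1 (mulmx^~ (invmx (J F)))); rewrite mulmxK ?J_unit // mul0mx.
    have := congr1 (mulmx^~ (E (i + 1))^T) vW0; have := congr1 (mulmx^~ (E (i + 2))^T) vW0.
    rewrite !mul0mx mulmxBr !mulmxBl /omega !mulmxA.
    rewrite -![_ *m _^T *m _^T]mulmxA !DE0 !eqxx i12 eq_sym i12.
    rewrite -scalemx1 scale0r !mulmx0 subr0 sub0r -scalemx1 scale1r !mulmx1.
    by move=> /eqP; rewrite oppr_eq0 => /eqP/cancelJ -> /cancelJ ->.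
  have xynz : (x, y) != (0, 0).
    apply/eqP => -[x0 y00]; have {}WE : W = 0 by rewrite WE x0 y00 !scale0r subrr.
    have := vW (delta_mx 0 0 *m E (i + 1)); rewrite WE mulmx0 mem_E => -[/(_ erefl)[+ _] _].
    rewrite -mulmxA (adapted_mulED _ _ fED) eqxx mulmx1 => /matrixP/(_ 0 0)/eqP.
    by rewrite !mxE oner_eq0.
  have rkW : (\rank W <= 4)%N.
    have rk2 k : (\rank (omega (D k)) <= 2)%N.
      exact: leq_trans (mxrankM_maxr _ _) (rank_leq_row _).
    apply: leq_trans (mxrank_add _ _) _; rewrite mxrank_opp.
    exact: (leq_add (rk2 _) (rk2 _)).
  move: rkW; rewrite WE rk4 // => -[k xyk]; exists k.
  apply/vspaceP => v; rewrite memv_ker lfunE /=.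
  suff [t tnz WE'] : exists2 t, t != 0 & t *: (lam k *: A - mu k *: B) = W.
    apply/eqP/idP => [v0 | /vW].
      by apply/vW; rewrite -WE' -scalemxAr v0 scaler0.
    rewrite -WE' -scalemxAr => /eqP; rewrite scaler_eq0 (negPf tnz).
    by move/eqP.
  (* The proportionality factor is read off from whichever of [lam k], [mu k] is known to be
     nonzero. *)
  rewrite WE; have [lk|lk] := eqVneq (lam k) 0.
    have mk : mu k != 0 by have := nz k; rewrite lk xpair_eqE eqxx.
    have x0 : x = 0.
      by move/eqP: xyk; rewrite lk mulr0 mulf_eq0 (negPf mk) orbF => /eqP.
    exists (y / mu k).
      by move: xynz; rewrite x0 xpair_eqE eqxx => y_nz; rewrite mulf_neq0 ?invr_eq0.
    by rewrite lk x0 !scale0r !sub0r scalerN scalerA divfK.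
  have yE : y = x / lam k * mu k by rewrite mulrAC xyk mulfK.
  exists (x / lam k).
    by apply: contraNneq xynz => t0; rewrite yE t0 mul0r -[x](divfK lk) t0 mul0r.
  by rewrite scalerBr !scalerA -yE divfK.
have sinj : injective s by move=> i j sij; apply: Einj; rewrite -!sE sij.
by exists (perm sinj) => i; rewrite permE.
Qed.
End Normal.

(** * Lines in an adapted frame *)

Section Classification.
Variable F : fieldType.
Local Notation e0 := (delta_mx 0 0 : 'rV[F]_2).
Local Notation f0 := (delta_mx 0 0 : 'cV[F]_2).
Local Notation f1 := (delta_mx 1 0 : 'cV[F]_2).

(** Coordinate blocks of a line of X meeting V, once each row space has been rotated into the first
    axis. *)
Definition rk1 (u : 'I_3 -> 'cV[F]_2) : 'I_3 -> 'M[F]_2 := fun i => u i *m e0.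

Definition shape1 : 'I_3 -> 'M[F]_2 := rk1 (fun i => [:: f0; f1; 0]`_i).
Definition shape2 : 'I_3 -> 'M[F]_2 := rk1 (fun i => [:: f0; f1; f1]`_i).
Definition shape3 : 'I_3 -> 'M[F]_2 := rk1 (fun i => [:: f0; f1; f0 + f1]`_i).
Definition shape4 : 'I_3 -> 'M[F]_2 := fun=> 1%:M.

Definition cols (a b : 'cV[F]_2) : 'M[F]_2 :=
  \matrix_(i, j) if j == 0 then a i 0 else b i 0.

Lemma cols_mul a b w : cols a b *m w = w 0 0 *: a + w 1 0 *: b.
Proof.
apply/matrixP => i j; rewrite !mxE sumI2 !mxE /= !ord1.
by rewrite mulrC [X in _ + X]mulrC.
Qed.

Lemma cols_unit a b :
  (forall x : 'rV_2, x *m a = 0 -> x *m b = 0 -> x = 0) -> cols a b \in unitmx.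
Proof.
move=> inj; rewrite -row_free_unit; apply: inj_row_free => x xh; apply: inj.
  have <- : cols a b *m f0 = a by rewrite cols_mul !mxE /= scale1r scale0r addr0.
  by rewrite mulmxA xh mul0mx.
have <- : cols a b *m f1 = b by rewrite cols_mul !mxE /= scale1r scale0r add0r.
by rewrite mulmxA xh mul0mx.
Qed.

Lemma mul_f0 (x : 'rV[F]_2) : x *m f0 = 0 <-> x 0 0 = 0.
Proof.
rewrite -colE; split=> [/matrixP/(_ 0 0)|x0]; first by rewrite !mxE.
by apply/matrixP => i j; rewrite !mxE !ord1.
Qed.

Lemma mul_f1 (x : 'rV[F]_2) : x *m f1 = 0 <-> x 0 1 = 0.
Proof.
rewrite -colE; split=> [/matrixP/(_ 0 0)|x0]; first by rewrite !mxE.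
by apply/matrixP => i j; rewrite !mxE !ord1.
Qed.

Lemma mul_f01 (x : 'rV[F]_2) : x *m f0 = 0 -> x *m f1 = 0 -> x = 0.
Proof.
move=> /mul_f0 x0 /mul_f1 x1; apply/rowP => i; rewrite mxE.
by elim/I2_ind: i.
Qed.

Lemma mul_e0_eq0 m (w : 'M[F]_(m, 1)) : w *m e0 = 0 <-> w = 0.
Proof.
split=> [|->]; last by rewrite mul0mx.
move=> /(congr1 (mulmx^~ f0)); rewrite -mulmxA mul_delta_mx.
rewrite (_ : delta_mx 0 0 = 1%:M) ?mulmx1 ?mul0mx //.
by apply/matrixP => i j; rewrite !mxE !ord1.
Qed.

Lemma det_rk1 u i : \det (rk1 u i) = 0.
Proof. by rewrite det_mx22 !mxE !big_ord1 !mxE /= !mulr0 mul0r subrr. Qed.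

Lemma col_annihilator (w : 'cV[F]_2) : exists2 x : 'rV_2, x != 0 & x *m w = 0.
Proof.
have /det0P[x xnz xw] : \det (w *m e0) == 0 by rewrite (det_rk1 (fun=> w) 0).
by exists x => //; apply/mul_e0_eq0; rewrite -mulmxA.
Qed.

Lemma annihilated_proportional (x : 'rV[F]_2) (a b : 'cV[F]_2) :
  x != 0 -> x *m a = 0 -> x *m b = 0 -> a != 0 -> exists t, b = t *: a.
Proof.
move=> xnz /matrixP/(_ 0 0) + /matrixP/(_ 0 0) + anz.
rewrite !mxE !sumI2 => xa xb.
have det0 : a 0 0 * b 1 0 = a 1 0 * b 0 0.
  apply/eqP; rewrite -subr_eq0.
  have xd i : x 0 i * (a 0 0 * b 1 0 - a 1 0 * b 0 0) = 0.
    elim/I2_ind: i.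
      transitivity (b 1 0 * (x 0 0 * a 0 0 + x 0 1 * a 1 0)
        - a 1 0 * (x 0 0 * b 0 0 + x 0 1 * b 1 0)); first by ring.
      by rewrite xa xb; ring.
    transitivity (a 0 0 * (x 0 0 * b 0 0 + x 0 1 * b 1 0)
      - b 0 0 * (x 0 0 * a 0 0 + x 0 1 * a 1 0)); first by ring.
    by rewrite xa xb; ring.
  apply: contraNT xnz => dnz; apply/eqP/rowP => i; apply/eqP.
  by have /eqP := xd i; rewrite mulf_eq0 (negPf dnz) orbF mxE.
have [a0|a0] := eqVneq (a 0 0) 0; last first.
  exists (b 0 0 / a 0 0); apply/colP => i; rewrite mxE.
  elim/I2_ind: i; first by rewrite divfK.
  by apply: (mulfI a0); rewrite det0; field.
have a1 : a 1 0 != 0.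
  apply: contraNneq anz => a1; apply/eqP/colP => i; rewrite mxE.
  by elim/I2_ind: i.
exists (b 1 0 / a 1 0); apply/colP => i; rewrite mxE.
elim/I2_ind: i; last by rewrite divfK.
by apply: (mulfI a1); rewrite -det0 a0; field.
Qed.

(** The rows of M lie on one line through the origin, and SL_2 moves the first axis to any such
    line. *)
Lemma det0_rk1 (M : 'M[F]_2) : \det M = 0 ->
  exists (u : 'cV_2) (g : 'M_2), \det g = 1 /\ M = u *m e0 *m g.
Proof.
rewrite -det_tr => /eqP/det0P[x xnz /matrixP xM].
have {}xM i : x 0 0 * M i 0 + x 0 1 * M i 1 = 0.
  by have := xM 0 i; rewrite !mxE sumI2 !mxE.
have [x0|x0] := eqVneq (x 0 0) 0.
  have x1 : x 0 1 != 0.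
    apply: contraNneq xnz => x1; apply/eqP/rowP => i; rewrite mxE.
    by elim/I2_ind: i.
  exists (col 0 M), 1%:M; split; first by rewrite det1.
  rewrite mulmx1; apply/matrixP => i j; rewrite !mxE big_ord1 !mxE eqxx /=.
  elim/I2_ind: j; rewrite /= ?mulr1 ?mulr0 //.
  by apply: (mulfI x1); rewrite mulr0 -(xM i) x0 mul0r add0r.
(* The first row spans the annihilator of x, which contains the rows of M; the second only
   normalises the determinant to 1. *)
pose g : 'M[F]_2 := \matrix_(i, j) if i == 0 then [:: - (x 0 1); x 0 0]`_j
  else [:: - (x 0 0)^-1; 0]`_j.
exists ((x 0 0)^-1 *: col 1 M), g; split.
  by rewrite det_mx22 !mxE /=; field.
apply/matrixP => i j; rewrite !mxE sumI2 !mxE !big_ord1 !mxE /=.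
elim/I2_ind: j; last by rewrite /=; field.
apply: (mulfI x0).
transitivity (- (x 0 1 * M i 1)); last by rewrite /=; field.
by apply/eqP; rewrite -addr_eq0 xM.
Qed.

Lemma perm_of_pair (i j : 'I_3) : i != j ->
  exists s : {perm 'I_3}, s 0 = i /\ s 1 = j.
Proof.
move=> ij; exists (tperm 0%R i * tperm (tperm 0%R i 1%R) j)%g; rewrite !permM.
have t1i : tperm 0 i 1 != i by rewrite -[X in _ != X](tpermL 0 i) (inj_eq perm_inj).
by rewrite !tpermL (tpermD t1i) // eq_sym.
Qed.

(** * Independence of the numbering of the exceptional lines *)

Section Permutation.
Variables (A B : 'M[F]_6) (L : 'I_3 -> {vspace 'rV[F]_6}) (s : {perm 'I_3}).
Local Notation Ls := (fun i => L (s i)).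

Lemma V_perm j : V_ Ls j = V_ L (s j).
Proof.
rewrite /V_ [RHS](reindex_inj (@perm_inj _ s)); apply: eq_bigl => i.
by rewrite (inj_eq perm_inj).
Qed.

Lemma o1_perm : o1 A B Ls = o1 A B L.
Proof.
apply/seteqP; split=> l [Xl [i [j [ij mi mj]]]]; split=> //.
  by exists (s i), (s j); rewrite (inj_eq perm_inj).
by exists (s^-1 i)%g, (s^-1 j)%g; rewrite (inj_eq perm_inj) !permKV.
Qed.

Lemma o2_perm : o2 A B Ls = o2 A B L.
Proof.
apply/seteqP; split=> l [Xl [i [mi uniq]]]; split=> //.
  exists (s i); split=> // k mk; rewrite -[k](permKV s); congr (s _).
  by apply: uniq; rewrite permKV.
exists (s^-1 i)%g; split=> [|k /uniq ->]; by rewrite ?permKV ?permK.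
Qed.

Lemma meets_V_perm l : meets_V Ls l <-> meets_V L l.
Proof.
split=> -[j mj]; first by exists (s j); rewrite -V_perm.
by exists (s^-1 j)%g; rewrite V_perm permKV.
Qed.

Lemma o3_perm : o3 A B Ls = o3 A B L.
Proof.
apply/seteqP; split=> l [Xl /meets_V_perm mV nm]; split=> // i.
by rewrite -(permKV s i).
Qed.

Lemma o4_perm : o4 A B Ls = o4 A B L.
Proof.
by apply/seteqP; split=> l [Xl nV]; split=> // /meets_V_perm.
Qed.
End Permutation.

End Classification.

(** * Incidence and membership in X in frame coordinates *)

Section Orbits.
Variable F : fieldType.
Hypothesis two0 : (2 : F) != 0.
Local Notation meets := (@Defs.meets F).
Local Notation e0 := (delta_mx 0 0 : 'rV[F]_2).
Local Notation f0 := (delta_mx 0 0 : 'cV[F]_2).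
Local Notation f1 := (delta_mx 1 0 : 'cV[F]_2).
Variables A B : 'M[F]_6.
Hypotheses (aA : antisym A) (aB : antisym B).
Implicit Types (E : 'I_3 -> 'M[F]_(2, 6)) (D : 'I_3 -> 'M[F]_(6, 2)).

Definition lines E : 'I_3 -> {vspace 'rV[F]_6} := fun i => rowspan (E i).

Lemma mem_lines E D i v : adapted A B E D ->
  v \in lines E i <-> forall j, j != i -> v *m D j = 0.
Proof.
move=> fED; split=> [/rowspanP[u ->] j /negPf ji|v0].
  by rewrite -mulmxA (adapted_mulED _ _ fED) eq_sym ji mulmx0.
rewrite (adapted_decomp v fED) (bigD1 i) //= big1 ?addr0 ?mem_row_rowspan // => j ji.
by rewrite v0 // mul0mx.
Qed.

Lemma mem_V E D j v : adapted A B E D -> v \in V_ (lines E) j <-> v *m D j = 0.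
Proof.
move=> fED; split=> [/memv_sumP[w wE ->]|v0].
  rewrite mulmx_suml big1 // => i ij.
  by apply: (iffLR (mem_lines _ _ fED) (wE i ij)); rewrite eq_sym.
rewrite (adapted_decomp v fED) (bigD1 j) //= v0 mul0mx add0r.
by apply: memv_sumr => i _; apply: mem_row_rowspan.
Qed.

Section Line.
Variables (E : 'I_3 -> 'M[F]_(2, 6)) (D : 'I_3 -> 'M[F]_(6, 2)) (N : 'M[F]_(2, 6)).
Hypotheses (fED : adapted A B E D) (Nfree : row_free N).
Local Notation l := (rowspan N).

Lemma meets_rowspan U :
  meets l U <-> exists2 u : 'rV_2, u != 0 & u *m N \in U.
Proof.
split=> [/meetsP[v vnz /andP[/rowspanP[u vE] vU]]|[u unz uU]].
  exists u; last by rewrite -vE.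
  by apply: contraNneq vnz => u0; rewrite vE u0 mul0mx.
apply/meetsP; exists (u *m N); last by rewrite mem_row_rowspan.
by apply: contraNneq unz => /(row_free_mul0 Nfree) ->.
Qed.

Lemma meets_linesE i : meets l (lines E i) <->
  exists2 u : 'rV_2, u != 0 & forall j, j != i -> u *m (N *m D j) = 0.
Proof.
rewrite meets_rowspan; split=> -[u unz uE]; exists u => //.
  by move=> j ji; rewrite mulmxA; apply: (iffLR (mem_lines _ _ fED)) ji.
by apply/(mem_lines _ _ fED) => j ji; rewrite -mulmxA uE.
Qed.

(** V_j is the kernel of the coordinate map [D j], so an intersection point is a nonzero row vector
    killed by the j-th block. *)
Lemma meets_VE j : meets l (V_ (lines E) j) <-> \det (N *m D j) = 0.
Proof.
rewrite meets_rowspan; split=> [[u unz /(mem_V _ _ fED) uE]|/eqP/det0P[u unz uE]].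
  by apply/eqP/det0P; exists u; rewrite ?mulmxA.
by exists u => //; apply/(mem_V _ _ fED); rewrite -mulmxA.
Qed.

(** By [congrJ] a form restricts to the line as its weighted sum of block determinants, which
    vanishes for all weights of sum 0 iff the determinants agree. *)
Lemma X_frame : X A B l <-> forall i j, \det (N *m D i) = \det (N *m D j).
Proof.
have [_ _ span] := fED.
have NWN w : N *m (\sum_i w i *: omega (D i)) *m N^T =
    (\sum_i w i * \det (N *m D i)) *: J F.
  rewrite mulmx_sumr mulmx_suml scaler_suml; apply: eq_bigr => i _.
  by rewrite -scalemxAr -scalemxAl -scalerA -congrJ /omega trmx_mul !mulmxA.
rewrite (X_P two0 aA aB Nfree); split=> [[NA NB] i j|deq]; last first.
  have zero W : W \in <<[:: A; B]>>%VS -> N *m W *m N^T = 0.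
    move=> /span[w w0 ->]; rewrite NWN.
    under eq_bigr => i _ do rewrite (deq i 0).
    by rewrite -mulr_suml w0 mul0r scale0r.
  by split; apply: zero; rewrite memv_span // !inE eqxx ?orbT.
have [->//|ij] := eqVneq i j.
pose w k : F := (k == i)%:R - (k == j)%:R.
have sumw (f : 'I_3 -> F) : \sum_k w k * f k = f i - f j.
  under eq_bigr => k _ do rewrite mulrBl.
  rewrite sumrB (bigD1 i) //= [X in _ - X](bigD1 j) //= !big1 ?eqxx ?mul1r ?addr0 //.
    by move=> k /negPf ->; rewrite mul0r.
  by move=> k /negPf ->; rewrite mul0r.
have /span2P[x [y WE]] : \sum_k w k *: omega (D k) \in <<[:: A; B]>>%VS.
  apply/span; exists w => //; have := sumw (fun=> 1); rewrite subrr.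
  by under eq_bigr do rewrite mulr1.
have := NWN w; rewrite WE sumw mulmxDr mulmxDl -!scalemxAr -!scalemxAl NA NB.
rewrite !scaler0 addr0 => /esym/eqP; rewrite scaler_eq0 (negPf (J_neq0 F)) orbF.
by rewrite subr_eq0 => /eqP.
Qed.

Lemma frame_sum0 (u : 'rV_2) : (forall i, u *m (N *m D i) = 0) -> u = 0.
Proof.
move=> uND; apply: row_free_mul0 Nfree _; rewrite (adapted_decomp (u *m N) fED).
by rewrite big1 // => i _; rewrite -(mulmxA u) uND mul0mx.
Qed.

Lemma rank1_frame : (forall i, \det (N *m D i) = 0) ->
  exists E' D' u, [/\ adapted A B E' D', lines E' = lines E
    & N = \sum_i rk1 u i *m E' i].
Proof.
move=> det0; have /fin_all_exists[u] i := det0_rk1 (det0 i).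
move=> /fin_all_exists[g ug].
exists (fun i => g i *m E i), (fun i => D i *m invmx (g i)), u.
have g1 i : \det (g i) = 1 by case: (ug i).
split; first exact: adapted_change.
  by apply/funext => i; rewrite /lines rowspan_unit // unitmxE g1 unitr1.
rewrite [LHS](adapted_decomp N fED); apply: eq_bigr => i _.
by rewrite mulmxA; case: (ug i) => _ <-.
Qed.

(** The u_i matter only up to a common h, a change of basis of the line, and separate scalars,
    absorbed by the unimodular diag(1/t_i, t_i) in block i. *)
Lemma rank1_class u c (t : 'I_3 -> F) (h : 'M[F]_2) :
  N = \sum_i rk1 u i *m E i -> h \in unitmx -> (forall i, t i != 0) ->
  (forall i, t i *: u i = h *m c i) -> frame_class A B (rk1 c) l.
Proof.
move=> NE hu tnz tu.
pose g i : 'M[F]_2 := dil (t i)^-1 *m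
  \matrix_(a, b) if a == b then (if a == 0 then 1 else t i) else 0.
have g1 i : \det (g i) = 1.
  by rewrite det_mulmx det_dil det_mx22 !mxE /= mul1r mul0r subr0 mulVf.
exists (fun i => g i *m E i), (fun i => D i *m invmx (g i)); split.
  exact: adapted_change.
rewrite -[RHS](rowspan_unit _ hu); congr rowspan; rewrite NE mulmx_sumr.
apply: eq_bigr => i _; rewrite [rk1 c i *m _]mulmxA [h *m _]mulmxA; congr (_ *m _).
have eg : e0 *m g i = (t i)^-1 *: e0.
  apply/rowP => j; rewrite -rowE !mxE sumI2 !mxE /=.
  by elim/I2_ind: j; rewrite /=; ring.
by rewrite /rk1 -(mulmxA (c i)) eg -!scalemxAr mulmxA -tu -scalemxAl scalerA mulVf ?scale1r.
Qed.
End Line.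

Lemma rk1_mulED E D u j : adapted A B E D -> (\sum_i rk1 u i *m E i) *m D j = rk1 u j.
Proof. exact: adapted_sumED. Qed.

End Orbits.

(** * The four classes of lines *)

Section OrbitShapes.
Variable F : fieldType.
Hypothesis two0 : (2 : F) != 0.
Local Notation meets := (@Defs.meets F).
Local Notation e0 := (delta_mx 0 0 : 'rV[F]_2).
Local Notation f0 := (delta_mx 0 0 : 'cV[F]_2).
Local Notation f1 := (delta_mx 1 0 : 'cV[F]_2).
Variables A B : 'M[F]_6.
Hypotheses (aA : antisym A) (aB : antisym B).
Implicit Types (E : 'I_3 -> 'M[F]_(2, 6)) (D : 'I_3 -> 'M[F]_(6, 2)).

Lemma line_rowspan (l : {vspace 'rV[F]_6}) : G15 l ->
  exists2 N : 'M[F]_(2, 6), row_free N & l = rowspan N.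
Proof. by rewrite /G15 /= => l2; move: (rowspan_ex l); rewrite l2. Qed.

Lemma meets_V_of_line (L : 'I_3 -> {vspace 'rV[F]_6}) l i :
  meets l (L i) -> meets_V L l.
Proof.
move=> /meetsP[v vnz /andP[vl vi]]; exists (i + 1); apply/meetsP; exists v => //.
rewrite vl; apply: subvP (v) vi; apply: (sumv_sup i) => //.
by elim/I3_ind: i.
Qed.

(** One vanishing determinant forces all three to vanish, by [X_frame], so every block can be put in
    rank-one form. *)
Lemma degenerate_line E D l : adapted A B E D -> X A B l -> meets_V (lines E) l ->
  exists E' D' N u, [/\ adapted A B E' D', lines E' = lines E, row_free N,
    l = rowspan N & N = \sum_i rk1 u i *m E' i].
Proof.
move=> fED Xl; have [N Nfree lE] := line_rowspan (proj1 Xl); subst l.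
move=> [j /(meets_VE fED Nfree) detj].
have [|E' [D' [u [fED' linesE NE]]]] := @rank1_frame _ A B E D N fED.
  by move=> i; rewrite -detj; apply: (iffLR (X_frame two0 aA aB fED Nfree) Xl).
by exists E', D', N, u.
Qed.

Section Degenerate.
Variables (E : 'I_3 -> 'M[F]_(2, 6)) (D : 'I_3 -> 'M[F]_(6, 2)) (N : 'M[F]_(2, 6)).
Variable u : 'I_3 -> 'cV[F]_2.
Hypotheses (fED : adapted A B E D) (Nfree : row_free N).
Hypothesis NE : N = \sum_i rk1 u i *m E i.
Local Notation l := (rowspan N).

Lemma meets_rk1 i : meets l (lines E i) <->
  exists2 x : 'rV_2, x != 0 & forall j, j != i -> x *m u j = 0.
Proof.
rewrite (meets_linesE fED Nfree); split=> -[x xnz xu]; exists x => // j /xu.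
all: rewrite NE (rk1_mulED _ _ fED) /rk1 mulmxA.
  by move/mul_e0_eq0.
by move=> ->; rewrite mul0mx.
Qed.

Lemma rk1_span (x : 'rV_2) : (forall i, x *m u i = 0) -> x = 0.
Proof.
move=> xu; apply: (frame_sum0 fED Nfree) => i.
by rewrite NE (rk1_mulED _ _ fED) mulmxA xu mul0mx.
Qed.

(** Here u_1, u_2 are dependent and so are u_0, u_2. As the u_i span the plane, u_2 = 0 and u_0, u_1
    form a basis. *)
Lemma two_lines_shape1 :
  meets l (lines E 0) -> meets l (lines E 1) -> frame_class A B (shape1 F) l.
Proof.
move=> /meets_rk1[x xnz xu] /meets_rk1[y ynz yu].
have u20 : u 2 = 0.
  apply/eqP; apply: contraT => u2nz.
  have [t u1E] := annihilated_proportional xnz (xu 2 isT) (xu 1 isT) u2nz.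
  case/eqP: ynz; apply: rk1_span; elim/I3_ind; [exact: yu| |exact: yu].
  by rewrite u1E -scalemxAr yu ?scaler0.
apply: (rank1_class fED (t := fun=> 1) (h := cols (u 0) (u 1)) NE).
- by apply: cols_unit => z z0 z1; apply: rk1_span; elim/I3_ind; rewrite // u20 mulmx0.
- by move=> i; apply: oner_neq0.
move=> i; rewrite scale1r.
by elim/I3_ind: i; rewrite /= cols_mul !mxE /= ?scale1r ?scale0r ?addr0 ?add0r.
Qed.

Lemma one_line_shape2 : meets l (lines E 0) -> ~ meets l (lines E 1) ->
  ~ meets l (lines E 2) -> frame_class A B (shape2 F) l.
Proof.
move=> /meets_rk1[x xnz xu] nm1 nm2.
(* If u_1 were zero, a nonzero row killing u_0 would give a point of the line on the exceptional
   line numbered 2; the case of u_2 is symmetric. *)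
have u1nz : u 1 != 0.
  apply/eqP => u1; apply: nm2; have [y ynz y0] := col_annihilator (u 0).
  by apply/meets_rk1; exists y => //; elim/I3_ind; rewrite // u1 mulmx0.
have u2nz : u 2 != 0.
  apply/eqP => u2; apply: nm1; have [y ynz y0] := col_annihilator (u 0).
  by apply/meets_rk1; exists y => //; elim/I3_ind; rewrite // u2 mulmx0.
have [t u2E] := annihilated_proportional xnz (xu 1 isT) (xu 2 isT) u1nz.
have tnz : t != 0 by apply: contraNneq u2nz => t0; rewrite u2E t0 scale0r.
apply: (rank1_class fED (t := fun i => [:: 1; t; 1]`_i) (h := cols (u 0) (u 2)) NE).
- apply: cols_unit => z z0; rewrite u2E -scalemxAr => /eqP.
  rewrite scaler_eq0 (negPf tnz) => /eqP z1.
  by apply: rk1_span; elim/I3_ind; rewrite // u2E -scalemxAr z1 scaler0.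
- by elim/I3_ind; rewrite /= ?oner_neq0.
move=> i; rewrite cols_mul.
by elim/I3_ind: i; rewrite /= !mxE /= ?scale1r ?scale0r ?addr0 ?add0r ?u2E.
Qed.

Lemma no_line_shape3 :
  (forall i, ~ meets l (lines E i)) -> frame_class A B (shape3 F) l.
Proof.
(* Missing the k-th line means that the other two vectors are independent. Hence u_2 is a
   combination of u_0 and u_1 with both coefficients nonzero, and these coefficients can be scaled
   to 1. *)
move=> nm; have indep (x : 'rV_2) i j k :
    (forall m, m != k -> m = i \/ m = j) -> x *m u i = 0 -> x *m u j = 0 -> x = 0.
  move=> ijk xi xj; apply/eqP; apply: contraT => xnz; case: (nm k).
  by apply/meets_rk1; exists x => // m /ijk[] ->.
have i01 (x : 'rV_2) : x *m u 0 = 0 -> x *m u 1 = 0 -> x = 0.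
  by apply: (indep _ _ _ 2); elim/I3_ind => //; auto.
have i02 (x : 'rV_2) : x *m u 0 = 0 -> x *m u 2 = 0 -> x = 0.
  by apply: (indep _ _ _ 1); elim/I3_ind => //; auto.
have i12 (x : 'rV_2) : x *m u 1 = 0 -> x *m u 2 = 0 -> x = 0.
  by apply: (indep _ _ _ 0); elim/I3_ind => //; auto.
have hu := cols_unit i01.
have [w u2E] : exists w : 'cV_2, u 2 = w 0 0 *: u 0 + w 1 0 *: u 1.
  by exists (invmx (cols (u 0) (u 1)) *m u 2); rewrite -cols_mul mulKVmx.
have w0 : w 0 0 != 0.
  apply/eqP => w0; have [x /eqP xnz x1] := col_annihilator (u 1).
  by apply: xnz; apply: i12 => //; rewrite u2E w0 scale0r add0r -scalemxAr x1 scaler0.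
have w1 : w 1 0 != 0.
  apply/eqP => w1; have [x /eqP xnz x1] := col_annihilator (u 0).
  by apply: xnz; apply: i02 => //; rewrite u2E w1 scale0r addr0 -scalemxAr x1 scaler0.
apply: (rank1_class fED (t := fun i => [:: w 0 0; w 1 0; 1]`_i)
  (h := cols (w 0 0 *: u 0) (w 1 0 *: u 1)) NE).
- apply: cols_unit => z; rewrite -!scalemxAr => /eqP + /eqP.
  rewrite !scaler_eq0 (negPf w0) (negPf w1) => /eqP + /eqP.
  exact: i01.
- by elim/I3_ind; rewrite /= ?oner_neq0.
move=> i; rewrite cols_mul.
by elim/I3_ind: i; rewrite /= !mxE /= ?addr0 ?add0r ?scale0r ?addr0 ?add0r !scale1r.
Qed.
End Degenerate.

Lemma o1_shape1 E D : adapted A B E D -> o1 A B (lines E) `<=` frame_class A B (shape1 F).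
Proof.
move=> fED l [Xl [i [j [ij mi mj]]]].
have [s [s0 s1]] := perm_of_pair ij; have fEs := adapted_perm s fED.
have [|E' [D' [N [u [fED' linesE' Nfree lE NE]]]]] := degenerate_line fEs Xl.
  by apply: (meets_V_of_line (i := 0)); rewrite /lines s0.
rewrite lE in mi mj *; apply: (two_lines_shape1 fED' Nfree NE).
  by rewrite linesE' /lines s0.
by rewrite linesE' /lines s1.
Qed.

Lemma o2_shape2 E D : adapted A B E D -> o2 A B (lines E) `<=` frame_class A B (shape2 F).
Proof.
move=> fED l [Xl [i [mi uniq]]].
have fEs := adapted_perm (tperm 0 i) fED.
have [|E' [D' [N [u [fED' linesE' Nfree lE NE]]]]] := degenerate_line fEs Xl.
  by apply: (meets_V_of_line (i := 0)); rewrite /lines tpermL.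
rewrite lE in mi uniq *; apply: (one_line_shape2 fED' Nfree NE).
- by rewrite linesE' /lines tpermL.
- by rewrite linesE' => /uniq iE; have /perm_inj := etrans (tpermL 0 i) iE.
- by rewrite linesE' => /uniq iE; have /perm_inj := etrans (tpermL 0 i) iE.
Qed.

Lemma o3_shape3 E D : adapted A B E D -> o3 A B (lines E) `<=` frame_class A B (shape3 F).
Proof.
move=> fED l [Xl mV nm].
have [E' [D' [N [u [fED' linesE' Nfree lE NE]]]]] := degenerate_line fED Xl mV.
rewrite lE in nm *; apply: (no_line_shape3 fED' Nfree NE) => i.
by rewrite linesE'; apply/negP.
Qed.

Lemma o4_shape4 E D : adapted A B E D -> o4 A B (lines E) `<=` frame_class A B (shape4 F).
Proof.
move=> fED l [Xl nV]; have [N Nfree lE] := line_rowspan (proj1 Xl); subst l.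
have dnz i : \det (N *m D i) != 0.
  by apply/eqP => d0; apply: nV; exists i; apply/(meets_VE fED Nfree).
have nu i : N *m D i \in unitmx by rewrite unitmxE unitfE.
(* Changing the basis of the line makes block 0 the identity; the other blocks then have determinant
   1, the determinants being equal, and are absorbed into the frame. *)
pose g i := invmx (N *m D 0) *m (N *m D i).
exists (fun i => g i *m E i), (fun i => D i *m invmx (g i)); split.
  apply: adapted_change => // i; rewrite det_mulmx det_inv.
  by rewrite (iffLR (X_frame two0 aA aB fED Nfree) Xl i 0) mulVf.
rewrite -[RHS](rowspan_unit _ (nu 0)); congr rowspan.
rewrite mulmx_sumr [LHS](adapted_decomp N fED); apply: eq_bigr => i _.
by rewrite mul1mx mulmxA /g mulKVmx.
Qed.

Lemma shape_row_free E D (c : 'I_3 -> 'M[F]_2) : adapted A B E D ->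
  (forall x : 'rV_2, (forall i, x *m c i = 0) -> x = 0) ->
  row_free (\sum_i c i *m E i).
Proof.
move=> fED cinj; apply: inj_row_free => x xN; apply: cinj => i.
by rewrite -(adapted_sumED c i fED) mulmxA xN mul0mx.
Qed.

Lemma rk1_row_free E D (u : 'I_3 -> 'cV[F]_2) : adapted A B E D ->
  u 0 = f0 -> u 1 = f1 -> row_free (\sum_i rk1 u i *m E i).
Proof.
move=> fED u0 u1; apply: (shape_row_free fED) => x xc.
have xu i : x *m u i = 0 by have := xc i; rewrite /rk1 mulmxA => /mul_e0_eq0.
by apply: mul_f01; rewrite -?u0 -?u1.
Qed.

Lemma rk1_X E D (u : 'I_3 -> 'cV[F]_2) : adapted A B E D ->
  u 0 = f0 -> u 1 = f1 ->
  X A B (rowspan (\sum_i rk1 u i *m E i)) /\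
  meets_V (lines E) (rowspan (\sum_i rk1 u i *m E i)).
Proof.
move=> fED u0 u1; have Nfree := rk1_row_free fED u0 u1; split.
  by apply/(X_frame two0 aA aB fED Nfree) => i j; rewrite !(rk1_mulED _ _ fED) !det_rk1.
by exists 0; apply/(meets_VE fED Nfree); rewrite (rk1_mulED _ _ fED) det_rk1.
Qed.

Lemma shape1_o1 E D : adapted A B E D ->
  o1 A B (lines E) (rowspan (\sum_i shape1 F i *m E i)).
Proof.
move=> fED; have [//|//|Xl _] := @rk1_X E D (fun i => [:: f0; f1; 0]`_i) fED.
split=> //; exists 0, 1; split=> //.
  apply/(meets_rk1 fED (rk1_row_free fED _ _) erefl) => //.
  exists (delta_mx 0 0).
    by apply/eqP => /matrixP/(_ 0 0)/eqP; rewrite !mxE oner_eq0.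
  by elim/I3_ind => // _; rewrite /= ?mulmx0 // mul_f1 !mxE.
apply/(meets_rk1 fED (rk1_row_free fED _ _) erefl) => //.
exists (delta_mx 0 1).
  by apply/eqP => /matrixP/(_ 0 1)/eqP; rewrite !mxE oner_eq0.
by elim/I3_ind => // _; rewrite /= ?mulmx0 // mul_f0 !mxE.
Qed.

Lemma shape2_o2 E D : adapted A B E D ->
  o2 A B (lines E) (rowspan (\sum_i shape2 F i *m E i)).
Proof.
move=> fED; have [//|//|Xl _] := @rk1_X E D (fun i => [:: f0; f1; f1]`_i) fED.
split=> //; exists 0; split=> [|k].
  apply/(meets_rk1 fED (rk1_row_free fED _ _) erefl) => //.
  exists (delta_mx 0 0).
    by apply/eqP => /matrixP/(_ 0 0)/eqP; rewrite !mxE oner_eq0.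
  by elim/I3_ind => // _; rewrite /= mul_f1 !mxE.
move=> /(meets_rk1 fED (rk1_row_free fED erefl erefl) erefl)[x /eqP xnz xu].
elim/I3_ind: k xu => // xu; case: xnz; apply: mul_f01; try exact: (xu 0).
  exact: (xu 2).
exact: (xu 1).
Qed.

Lemma shape3_o3 E D : adapted A B E D ->
  o3 A B (lines E) (rowspan (\sum_i shape3 F i *m E i)).
Proof.
move=> fED; have [//|//|Xl mV] := @rk1_X E D (fun i => [:: f0; f1; f0 + f1]`_i) fED.
split=> // k; apply/negP.
move=> /(meets_rk1 fED (rk1_row_free fED erefl erefl) erefl)[x /eqP xnz xu]; apply: xnz.
elim/I3_ind: k xu => xu.
- have x1 : x *m f1 = 0 by exact: (xu 1).
  apply: mul_f01 => //; have := xu 2 isT; by rewrite /= mulmxDr x1 addr0.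
- have x0 : x *m f0 = 0 by exact: (xu 0).
  apply: mul_f01 => //; have := xu 2 isT; by rewrite /= mulmxDr x0 add0r.
- by apply: mul_f01; [exact: (xu 0) | exact: (xu 1)].
Qed.

Lemma shape4_o4 E D : adapted A B E D ->
  o4 A B (lines E) (rowspan (\sum_i shape4 F i *m E i)).
Proof.
move=> fED; have Nfree : row_free (\sum_i shape4 F i *m E i).
  by apply: (shape_row_free fED) => x /(_ 0); rewrite mulmx1.
split.
  by apply/(X_frame two0 aA aB fED Nfree) => i j; rewrite !(adapted_sumED _ _ fED).
move=> [j /(meets_VE fED Nfree)/eqP].
by rewrite (adapted_sumED _ _ fED) det1 oner_eq0.
Qed.

End OrbitShapes.

(** * The four orbits *)

Section General.
Variable F : fieldType.
Hypothesis two0 : (2 : F) != 0.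
Variables (A B : 'M[F]_6) (lam mu : 'I_3 -> F).
Hypothesis hgen : general A B lam mu.
Local Notation L := (exc_line A B lam mu).
Local Notation meets := (@Defs.meets F).

(** Indices from 4 on give the empty set, so [orbit_type_X] and [orbit_type_disjoint] need no bound
    on the index. *)
Let orbit_types : nat -> set {vspace 'rV[F]_6} :=
  nth set0 [:: o1 A B L; o2 A B L; o3 A B L; o4 A B L].

(** One frame suffices to bring every line of a type to its normal form. Conversely a normal form in
    any adapted frame has the right type, since its blocks are the exceptional lines up to order and
    the types ignore the order. *)
Lemma orbit_type_class k : (k < 4)%N ->
  exists c : 'I_3 -> 'M[F]_2, orbit_types k = frame_class A B c.
Proof.
have [[aA aB _] _ _ _] := hgen.
have [E [D fED]] := adapted_exists two0 hgen.
have lines_exc E' D' : adapted A B E' D' ->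
    exists s : {perm 'I_3}, lines E' = fun i => L (s i).
  by move=> /(exc_line_frame hgen)[s sE]; exists s; apply/funext => i; rewrite sE.
have [s sE] := lines_exc _ _ fED.
move: k => [|[|[|[|//]]]] _; rewrite /orbit_types /=.
- exists (shape1 F); apply/seteqP; split=> [|l [E' [D' [fED' ->]]]].
    by rewrite -(o1_perm _ _ _ s) -sE; apply: o1_shape1 fED.
  have [s' sE'] := lines_exc _ _ fED'.
  by rewrite -(o1_perm _ _ _ s') -sE'; apply: shape1_o1 fED'.
- exists (shape2 F); apply/seteqP; split=> [|l [E' [D' [fED' ->]]]].
    by rewrite -(o2_perm _ _ _ s) -sE; apply: o2_shape2 fED.
  have [s' sE'] := lines_exc _ _ fED'.
  by rewrite -(o2_perm _ _ _ s') -sE'; apply: shape2_o2 fED'.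
- exists (shape3 F); apply/seteqP; split=> [|l [E' [D' [fED' ->]]]].
    by rewrite -(o3_perm _ _ _ s) -sE; apply: o3_shape3 fED.
  have [s' sE'] := lines_exc _ _ fED'.
  by rewrite -(o3_perm _ _ _ s') -sE'; apply: shape3_o3 fED'.
exists (shape4 F); apply/seteqP; split=> [|l [E' [D' [fED' ->]]]].
  by rewrite -(o4_perm _ _ _ s) -sE; apply: o4_shape4 fED.
have [s' sE'] := lines_exc _ _ fED'.
by rewrite -(o4_perm _ _ _ s') -sE'; apply: shape4_o4 fED'.
Qed.

Lemma orbit_type_X k l : orbit_types k l -> X A B l.
Proof.
by case: k => [|[|[|[|k]]]]; rewrite /orbit_types /= ?nth_nil //; case.
Qed.

Lemma orbit_type_cover l : X A B l -> exists2 k, (k < 4)%N & orbit_types k l.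
Proof.
move=> Xl; have [mV|nV] := pselect (meets_V L l); last by exists 3%N.
have [[i mi]|nm] := pselect (exists i, meets l (L i)); last first.
  exists 2%N => //; split=> // i; apply/negP => mi; apply: nm; by exists i.
have [two|ntwo] := pselect (exists i j, [/\ i != j, meets l (L i) & meets l (L j)]).
  by exists 0%N.
exists 1%N => //; split=> //; exists i; split=> // j mj.
by apply/eqP; apply: contra_notT ntwo => ij; exists i, j.
Qed.

Lemma orbit_type_disjoint j k l : orbit_types j l -> orbit_types k l -> j = k.
Proof.
have d12 : ~ (o1 A B L l /\ o2 A B L l).
  move=> [[_ [i [j' [ij mi mj]]]] [_ [m [_ uniq]]]].
  by rewrite -(uniq i mi) -(uniq j' mj) eqxx in ij.
have d13 : ~ (o1 A B L l /\ o3 A B L l).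
  by move=> [[_ [i [j' [_ mi _]]]] [_ _ /(_ i)]]; rewrite mi.
have d23 : ~ (o2 A B L l /\ o3 A B L l).
  by move=> [[_ [i [mi _]]] [_ _ /(_ i)]]; rewrite mi.
have d14 : ~ (o1 A B L l /\ o4 A B L l).
  by move=> [[_ [i [j' [_ /meets_V_of_line mV _]]]] [_]].
have d24 : ~ (o2 A B L l /\ o4 A B L l).
  by move=> [[_ [i [/meets_V_of_line mV _]]] [_]].
have d34 : ~ (o3 A B L l /\ o4 A B L l) by move=> [[_ mV _] [_]].
move: j k => [|[|[|[|j]]]] [|[|[|[|k]]]]; rewrite /orbit_types /= ?nth_nil //; tauto.
Qed.

Lemma orbit_type_nonempty k : (k < 4)%N -> exists l, orbit_types k l.
Proof.
move=> /orbit_type_class[c ->]; have [E [D fED]] := adapted_exists two0 hgen.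
by exists (rowspan (\sum_i c i *m E i)), E, D.
Qed.

Lemma orbit_of_type k l : (k < 4)%N -> orbit_types k l ->
  Defs.orbit A B l = orbit_types k.
Proof. by move=> /orbit_type_class[c ->]; apply: orbit_frame_class. Qed.

Lemma orbits_types : orbits A B = orbit_types @` `I_4.
Proof.
apply/seteqP; split=> [_ [l Xl <-]|_ [k k4 <-]].
  have [k k4 lk] := orbit_type_cover Xl.
  by exists k => //; rewrite (orbit_of_type k4 lk).
have [l lk] := orbit_type_nonempty k4; exists l; first exact: orbit_type_X lk.
exact: orbit_of_type.
Qed.

Lemma orbits_o : orbits A B = [set o1 A B L; o2 A B L; o3 A B L; o4 A B L].
Proof.
rewrite orbits_types; apply/seteqP; split=> [_ [[|[|[|[|//]]]] _ <-]|o].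
- by left; left; left.
- by left; left; right.
- by left; right.
- by right.
by move=> [[[->|->]|->]|->]; [exists 0%N|exists 1%N|exists 2%N|exists 3%N].
Qed.

(** The four types are nonempty and pairwise disjoint, hence distinct as sets. *)
Lemma card_orbits : (orbits A B #= `I_4)%card.
Proof.
rewrite orbits_types; apply: inj_card_eq => j k /set_mem j4 _ jk.
have [l lj] := orbit_type_nonempty j4.
by apply: (orbit_type_disjoint lj); rewrite -jk.
Qed.
End General.

Theorem proposition2p1 (R : realType) (A B : 'M[R[i]]_6)
    (lam mu : 'I_3 -> R[i]) (hgen : general A B lam mu) :
  let L := exc_line A B lam mu in
  orbits A B = [set o1 A B L; o2 A B L; o3 A B L; o4 A B L] /\
  (orbits A B #= `I_4)%card.
Proof.
have two0 : (2 : R[i]) != 0 by rewrite Num.Theory.pnatr_eq0.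
by split; [exact: orbits_o | exact: (card_orbits _ hgen)].
Qed.
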